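(* Let a ''die'' be given by finitely many distinct nonzero integers $s_1,\dots,s_r$ with probabilities $q_1,\dots,q_r>0$, $\sum q_j=1$, with positive expected gain $\sum_j q_js_j>0$. A player starts with capital $0$ and at each round rolls the die independently and adds the outcome to the capital; let $X$ be the number of rounds until the capital is strictly positive for the first time. Then the sequence $a(k)=\Pr(X=k)$ is P-recursive: there exist a positive integer $L$ and polynomials $p_0(k),\dots,p_L(k)$, not all zero, such that $\sum_{i=0}^L p_i(k)\,a(k-i)=0$ for all $k\ge L$. Furthermore, there exists an algorithm for finding this linear recurrence. *)

(* Defs.v *)
From HB Require Import structures.
From mathcomp Require Import all_boot all_order all_algebra.
From mathcomp Require Import all_classical all_reals all_analysis.

Set Implicit Arguments.
Unset Strict Implicit.
Unset Printing Implicit Defensive.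

Import Order.TTheory GRing.Theory Num.Theory.

Local Open Scope classical_set_scope.
Local Open Scope ring_scope.

Record die (R : realType) := Die {
  faces : nat;
  face : 'I_faces -> int;
  weight : 'I_faces -> R;
  face_inj : injective face;
  face_neq0 : forall j, face j != 0;
  weight_gt0 : forall j, 0 < weight j;
  weight_sum1 : \sum_j weight j = 1;
  gain_gt0 : 0 < \sum_j weight j * (face j)%:~R }.

Arguments face {R} D j : rename.
Arguments weight {R} D j : rename.

Definition mutually_independent (R : realType) (d : measure_display)
    (T : measurableType d) (P : probability T R) (Y : nat -> {RV P >-> R}) :=
  forall (J : seq nat) (B : nat -> set R),
    uniq J -> (forall i, measurable (B i)) ->
    P (\bigcap_(i in [set` J]) (Y i @^-1` B i))
      = (\prod_(i <- J) P (Y i @^-1` B i))%E.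

(* [Y n] is the outcome of round [n.+1]. The weights sum to 1, so prescribing
   the mass of each face makes every other outcome negligible. *)
Definition independent_rolls (R : realType) (D : die R) (d : measure_display)
    (T : measurableType d) (P : probability T R) (Y : nat -> {RV P >-> R}) :=
  mutually_independent Y /\
  forall n j, pmf (Y n) (face D j)%:~R = weight D j.

Definition capital (R : realType) (T : Type) (Y : nat -> T -> R) (n : nat)
  (w : T) : R := \sum_(i < n) Y i w.

(* [None] when the capital never becomes positive. *)
Definition rounds (R : realType) (T : Type) (Y : nat -> T -> R) (w : T) :
    option nat :=
  if pselect (exists n, 0 < capital Y n w) is left h then Some (ex_minn h)
  else None.

Definition rounds_pmf (R : realType) (d : measure_display)
    (T : measurableType d) (P : probability T R) (Y : nat -> {RV P >-> R})
    (k : nat) : R :=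
  fine (P [set w | rounds (fun n => Y n : T -> R) w = Some k]).

(* Only [p 0], ..., [p L] matter; [k - i] is a genuine subtraction as
   [i <= L <= k]. *)
Definition satisfies_recurrence (R : realType) (a : nat -> R) (L : nat)
    (p : nat -> {poly R}) : Prop :=
  [/\ (0 < L)%N,
      exists2 i, (i <= L)%N & p i != 0
    & forall k, (L <= k)%N ->
        \sum_(i < L.+1) (p i).[k%:R] * a (k - i)%N = 0].

Definition P_recursive (R : realType) (a : nat -> R) : Prop :=
  exists L p, satisfies_recurrence a L p.

(* Algorithms are programs of a random access machine with exact arithmetic
   (a Blum-Shub-Smale machine): an integer memory, used for control and
   addressing, and a memory of scalars in [R], on which a program can only
   perform field operations and test equality. The programs themselves do not
   mention [R], so they contain no scalar constants other than 0 and 1; on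
   rational inputs every scalar ever stored is rational, and a program is then
   an ordinary (Turing) algorithm. *)
Inductive iexp :=
  | IConst of int
  | IGet of iexp
  | IAdd of iexp & iexp
  | ISub of iexp & iexp
  | IMul of iexp & iexp.

Inductive fexp :=
  | FZero
  | FOne
  | FGet of iexp
  | FAdd of fexp & fexp
  | FSub of fexp & fexp
  | FMul of fexp & fexp
  | FDiv of fexp & fexp.

Inductive bexp :=
  | BIntLe of iexp & iexp
  | BScalEq of fexp & fexp
  | BNot of bexp
  | BAnd of bexp & bexp.

Inductive cmd :=
  | Skip
  | ISet of iexp & iexp
  | FSet of iexp & fexp
  | Seq of cmd & cmd
  | If of bexp & cmd & cmd
  | While of bexp & cmd.

Record state (R : realType) := State {
  imem : int -> int;
  fmem : int -> R }.

Fixpoint ieval (R : realType) (st : state R) (e : iexp) : int :=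
  match e with
  | IConst z => z
  | IGet a => imem st (ieval st a)
  | IAdd e1 e2 => ieval st e1 + ieval st e2
  | ISub e1 e2 => ieval st e1 - ieval st e2
  | IMul e1 e2 => ieval st e1 * ieval st e2
  end.

(* Division by 0 returns 0. *)
Fixpoint feval (R : realType) (st : state R) (e : fexp) : R :=
  match e with
  | FZero => 0
  | FOne => 1
  | FGet a => fmem st (ieval st a)
  | FAdd e1 e2 => feval st e1 + feval st e2
  | FSub e1 e2 => feval st e1 - feval st e2
  | FMul e1 e2 => feval st e1 * feval st e2
  | FDiv e1 e2 => feval st e1 / feval st e2
  end.

Fixpoint beval (R : realType) (st : state R) (b : bexp) : bool :=
  match b with
  | BIntLe e1 e2 => ieval st e1 <= ieval st e2
  | BScalEq e1 e2 => feval st e1 == feval st e2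
  | BNot b1 => ~~ beval st b1
  | BAnd b1 b2 => beval st b1 && beval st b2
  end.

Definition update (V : Type) (m : int -> V) (a : int) (v : V) : int -> V :=
  fun z => if z == a then v else m z.

Inductive exec (R : realType) : cmd -> state R -> state R -> Prop :=
  | exec_skip st : exec Skip st st
  | exec_iset st a e :
      exec (ISet a e) st
        (State (update (imem st) (ieval st a) (ieval st e)) (fmem st))
  | exec_fset st a e :
      exec (FSet a e) st
        (State (imem st) (update (fmem st) (ieval st a) (feval st e)))
  | exec_seq c1 c2 st1 st2 st3 :
      exec c1 st1 st2 -> exec c2 st2 st3 -> exec (Seq c1 c2) st1 st3
  | exec_if_true b c1 c2 st1 st2 :
      beval st1 b -> exec c1 st1 st2 -> exec (If b c1 c2) st1 st2
  | exec_if_false b c1 c2 st1 st2 :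
      ~~ beval st1 b -> exec c2 st1 st2 -> exec (If b c1 c2) st1 st2
  | exec_while_true b c st1 st2 st3 :
      beval st1 b -> exec c st1 st2 -> exec (While b c) st2 st3 ->
      exec (While b c) st1 st3
  | exec_while_false b c st :
      ~~ beval st b -> exec (While b c) st st.

(* Input: integer cell 0 holds the number of faces, integer cell [j.+1] the
   face [j], scalar cell [j] its weight; all other cells hold 0. *)
Definition input (R : realType) (D : die R) : state R :=
  State
    (fun z => match z with
              | Posz 0 => (faces D)%:Z
              | Posz j.+1 => if insub j is Some i then face D i else 0
              | Negz _ => 0
              end)
    (fun z => match z with
              | Posz j => if insub j is Some i then weight D i else 0
              | Negz _ => 0
              end).

(* Output: integer cell 0 holds the order, integer cell 1 a bound [n] on the
   sizes (degree + 1) of the polynomials, and scalar cell [i * n + e] the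
   coefficient of ['X^e] in the [i]-th polynomial. *)
Definition output_order (R : realType) (st : state R) : nat := `|imem st 0|%N.

Definition output_poly (R : realType) (st : state R) (i : nat) : {poly R} :=
  let n := `|imem st 1|%N in \poly_(e < n) fmem st (i * n + e)%N%:Z.

(* Main.v *)
Require Import Defs.
From HB Require Import structures.
From mathcomp Require Import all_boot all_order all_algebra.
From mathcomp Require Import all_classical all_reals all_analysis.
From mathcomp Require Import perm zify ring.

(** Let [A] be the generating function of the law of [X].

    [A] is algebraic. Let [m] bound the sizes of the faces, and let [V_t] be the
    row vector of power series counting, by duration, the walks from capital
    [m - t] that first become positive at [m], ..., [1]. Decomposing a walk at
    the first time it climbs above its starting point gives [V_(t+1) = V_t C]
    with [C] a companion matrix such that [det (1 - C) = 1 - A], and the first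
    step gives a linear recurrence for [V_t] over [K[z]]. Hence multiplication
    by [1 - C] is represented over [K[z]], up to a scalar [ell], on the span of
    finitely many of the [V_t], and [ell^m (1 - A)] is an eigenvalue of the
    [m]-th tensor power of that matrix. This bounds the degrees of a polynomial
    [P] with [P(z, A) = 0] in terms of the faces only.

    Modulo [P], the polynomials of bounded bidegree in [(z, A)] span a space
    whose dimension grows linearly with the degrees. Counting dimensions shows
    first that a nonzero recurrence of explicit order and degree exists, and
    then that the powers of a nonzero value [h] of such a recurrence operator
    at [A] satisfy an equation whose constant term is a polynomial of explicit
    degree [E] divisible by [h], so that [h] has order at most [E]. A recurrence
    of this shape valid for the indices up to [E] is therefore valid for all
    indices.

    The algorithm computes [E + 1] terms of the sequence by dynamic programming,
    then solves the finite linear system for the coefficients by iterating an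
    orthogonal projector, and outputs a nonzero row of the projector. *)

Set Implicit Arguments.
Unset Strict Implicit.
Unset Printing Implicit Defensive.

Import Order.TTheory GRing.Theory Num.Theory.

Local Open Scope ring_scope.

(** * Formal power series *)

(** The wrapper lets sequences carry the Cauchy product rather than the pointwise product of
    functions. *)
Record fps (K : Type) := Fps { fcoef : nat -> K }.

HB.instance Definition _ (K : Type) := gen_eqMixin (fps K).
HB.instance Definition _ (K : Type) := gen_choiceMixin (fps K).

Lemma fpsP (K : Type) (f g : fps K) : (forall k, fcoef f k = fcoef g k) -> f = g.
Proof. by case: f g => [f] [g] /= /funext ->. Qed.

Section FpsRing.
Variable K : comNzRingType.
Implicit Types f g h : fps K.

Definition fps_add f g := Fps (fun k => fcoef f k + fcoef g k).
Definition fps_opp f := Fps (fun k => - fcoef f k).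
Definition fps_zero : fps K := Fps (fun=> 0).
Definition fps_mul f g :=
  Fps (fun k => \sum_(i < k.+1) fcoef f i * fcoef g (k - i)).
Definition fps_of_poly (p : {poly K}) : fps K := Fps (fun k => p`_k).

Fact fps_addA : associative fps_add.
Proof. by move=> f g h; apply: fpsP => k /=; rewrite addrA. Qed.
Fact fps_addC : commutative fps_add.
Proof. by move=> f g; apply: fpsP => k /=; rewrite addrC. Qed.
Fact fps_add0 : left_id fps_zero fps_add.
Proof. by move=> f; apply: fpsP => k /=; rewrite add0r. Qed.
Fact fps_addN : left_inverse fps_zero fps_opp fps_add.
Proof. by move=> f; apply: fpsP => k /=; rewrite addNr. Qed.

HB.instance Definition _ :=
  GRing.isZmodule.Build (fps K) fps_addA fps_addC fps_add0 fps_addN.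

Definition ftrunc n f : {poly K} := \poly_(i < n) fcoef f i.

Lemma coef_ftrunc n f k : (k < n)%N -> (ftrunc n f)`_k = fcoef f k.
Proof. by rewrite coef_poly => ->. Qed.

(** Coefficients of a product below [n] involve only coefficients below [n], so the ring laws of
    series are inherited from polynomials by truncation. *)
Lemma coef_ftruncM n f g k : (k < n)%N ->
  (ftrunc n f * ftrunc n g)`_k = fcoef (fps_mul f g) k.
Proof.
move=> kn; rewrite coefM; apply: eq_bigr => i _.
by have := ltn_ord i => ik; rewrite !coef_ftrunc //; lia.
Qed.

Fact fps_mulC : commutative fps_mul.
Proof.
by move=> f g; apply: fpsP => k; rewrite -!(@coef_ftruncM k.+1) // mulrC.
Qed.

Fact fps_mulA : associative fps_mul.
Proof.
move=> f g h; apply: fpsP => k.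
have -> : fcoef (fps_mul f (fps_mul g h)) k =
    (ftrunc k.+1 f * (ftrunc k.+1 g * ftrunc k.+1 h))`_k.
  rewrite coefM; apply: eq_bigr => i _.
  by rewrite coef_ftruncM ?coef_ftrunc // ltnS leq_subr.
rewrite mulrA coefM; apply: eq_bigr => i _.
by rewrite coef_ftruncM ?coef_ftrunc // ltnS leq_subr.
Qed.

Fact fps_mul1 : left_id (fps_of_poly 1) fps_mul.
Proof.
move=> f; apply: fpsP => k /=; rewrite big_ord_recl subn0 coef1 mul1r.
by rewrite big1 ?addr0 // => i _; rewrite coef1 mul0r.
Qed.

Fact fps_mulDl : left_distributive fps_mul fps_add.
Proof.
move=> f g h; apply: fpsP => k /=.
by rewrite -big_split; apply: eq_bigr => i _; rewrite mulrDl.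
Qed.

Fact fps_1_neq0 : fps_of_poly 1 != 0.
Proof.
apply/eqP => /(congr1 (fun f => fcoef f 0)) /= /eqP.
by rewrite coef1 oner_eq0.
Qed.

HB.instance Definition _ := GRing.Zmodule_isComNzRing.Build (fps K)
  fps_mulA fps_mulC fps_mul1 fps_mulDl fps_1_neq0.

Lemma fcoefD f g k : fcoef (f + g) k = fcoef f k + fcoef g k. Proof. by []. Qed.
Lemma fcoefN f k : fcoef (- f) k = - fcoef f k. Proof. by []. Qed.
Lemma fcoef0 k : fcoef (0 : fps K) k = 0. Proof. by []. Qed.
Lemma fcoefM f g k :
  fcoef (f * g) k = \sum_(i < k.+1) fcoef f i * fcoef g (k - i).
Proof. by []. Qed.
Lemma fcoef_sum (I : Type) (r : seq I) (Q : pred I) (F : I -> fps K) k :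
  fcoef (\sum_(i <- r | Q i) F i) k = \sum_(i <- r | Q i) fcoef (F i) k.
Proof. by elim/big_rec2: _ => // i y1 y2 _ <-. Qed.

Fact fps_of_poly_is_zmod_morphism : zmod_morphism fps_of_poly.
Proof. by move=> p q; apply: fpsP => k /=; rewrite coefB. Qed.
Fact fps_of_poly_is_monoid_morphism : monoid_morphism fps_of_poly.
Proof. by split=> // p q; apply: fpsP => k; rewrite fcoefM /= coefM. Qed.
HB.instance Definition _ := GRing.isZmodMorphism.Build _ _ fps_of_poly
  fps_of_poly_is_zmod_morphism.
HB.instance Definition _ := GRing.isMonoidMorphism.Build _ _ fps_of_poly
  fps_of_poly_is_monoid_morphism.

Lemma fcoef_poly p k : fcoef (fps_of_poly p) k = p`_k. Proof. by []. Qed.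

Lemma fcoefZ c f k : fcoef (fps_of_poly c%:P * f) k = c * fcoef f k.
Proof.
rewrite fcoefM big_ord_recl subn0 /= coefC eqxx big1 ?addr0 // => i _.
by rewrite coefC mul0r.
Qed.

Lemma fcoefXM f k :
  fcoef (fps_of_poly 'X * f) k = if k is k'.+1 then fcoef f k' else 0.
Proof.
rewrite fcoefM big_ord_recl /= coefX mul0r add0r.
case: k => [|k]; first by rewrite big_ord0.
rewrite big_ord_recl /= coefX mul1r subSS subn0 big1 ?addr0 // => i _.
by rewrite coefX mul0r.
Qed.

Lemma fcoefXnM n f k :
  fcoef (fps_of_poly 'X^n * f) k = if (n <= k)%N then fcoef f (k - n) else 0.
Proof.
elim: n k => [|n IHn] k; first by rewrite expr0 mul1r subn0.
by rewrite exprS rmorphM -mulrA fcoefXM; case: k.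
Qed.

(** The operator [z d/dz]: polynomial factors in the index [k] become combinations of its
    iterates. *)
Definition feuler f := Fps (fun k => fcoef f k *+ k).

Fact feuler_is_zmod_morphism : zmod_morphism feuler.
Proof. by move=> f g; apply: fpsP => k /=; rewrite mulrnBl. Qed.
HB.instance Definition _ := GRing.isZmodMorphism.Build _ _ feuler
  feuler_is_zmod_morphism.

Lemma feulerM f g : feuler (f * g) = feuler f * g + f * feuler g.
Proof.
apply: fpsP => k; rewrite fcoefD !fcoefM /= -big_split /= -sumrMnl.
apply: eq_bigr => i _; rewrite mulrnAl mulrnAr -mulrnDr subnKC //.
by rewrite -ltnS.
Qed.

Lemma feuler_poly p : feuler (fps_of_poly p) = fps_of_poly ('X * p^`()).
Proof.
apply: fpsP => -[|k] /=; rewrite coefXM /= ?mulr0n //.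
by rewrite coef_deriv.
Qed.

Lemma fcoef_iter_feuler e f k :
  fcoef (iter e feuler f) k = k%:R ^+ e * fcoef f k.
Proof.
elim: e => [|e IHe]; first by rewrite mul1r.
by rewrite iterS /= IHe exprS -mulrA mulr_natl.
Qed.

Lemma fcoefM_high n f g : (forall k, (k <= n)%N -> fcoef f k = 0) ->
  forall k, (k <= n)%N -> fcoef (f * g) k = 0.
Proof.
move=> f0 k kn; rewrite fcoefM big1 // => i _.
by rewrite f0 ?mul0r // (leq_trans _ kn) // -ltnS.
Qed.

End FpsRing.

(** The lowest nonzero coefficients of two nonzero series multiply to a nonzero coefficient of the
    product. *)
Lemma fps_mul_eq0 (K : idomainType) (f g : fps K) : f * g = 0 -> f = 0 \/ g = 0.
Proof.
move=> fg0; apply: contrapT => /not_orP [f0 g0].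
have low (h : fps K) : h <> 0 ->
    exists2 n, fcoef h n != 0 & forall k, (k < n)%N -> fcoef h k = 0.
  move=> h0; have exn : exists n, fcoef h n != 0.
    apply: contrapT => /forallNP H; apply: h0; apply: fpsP => k.
    by apply/eqP; apply: contrapT => /negP; apply: H.
  case: (ex_minnP exn) => n hn nmin; exists n => // k kn.
  by apply/eqP; apply: contraTT kn => /nmin; rewrite -leqNgt.
case: (low _ f0) => m fm mlow; case: (low _ g0) => n gn nlow.
have /eqP := congr1 (fun h => fcoef h (m + n)) fg0.
rewrite fcoefM fcoef0.
have mlt : (m < (m + n).+1)%N by lia.
rewrite (bigD1 (Ordinal mlt)) //= big1 ?addr0 => [|i im].
  by rewrite addKn mulf_eq0 (negPf fm) (negPf gn).
have {im} : i != m :> nat by rewrite -val_eqE in im.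
case: (ltngtP i m) => // im _; first by rewrite mlow // mul0r.
by have := ltn_ord i => ik; rewrite nlow ?mulr0 //; lia.
Qed.

Lemma fps_expf_neq0 (K : idomainType) (f : fps K) n : f <> 0 -> f ^+ n <> 0.
Proof.
move=> f0; elim: n => [|n IHn]; first by apply/eqP; rewrite expr0 oner_neq0.
by rewrite exprS => /fps_mul_eq0 [].
Qed.

(** * Polynomials in [z] and in an algebraic series *)

Lemma more_unknowns_than_equations (K : fieldType) (I J : finType)
    (F : I -> J -> K) : (#|J| < #|I|)%N ->
  exists2 c : I -> K, exists i, c i != 0 & forall j, \sum_i c i * F i j = 0.
Proof.
move=> JI; pose M := \matrix_(i < #|I|, j < #|J|) F (enum_val i) (enum_val j).
have kerM : kermx M != 0.
  rewrite kermx_eq0 /row_free neq_ltn; apply/orP; left.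
  by rewrite (leq_ltn_trans (rank_leq_col M)).
case/rowV0Pn: kerM => v /sub_kermxP vM v0.
exists (fun i => v 0 (enum_rank i)).
  case/rV0Pn: v0 => i vi; exists (enum_val i); by rewrite enum_valK.
move=> j; move/rowP/(_ (enum_rank j)): vM; rewrite !mxE => H; rewrite -[RHS]H.
rewrite (reindex (@enum_rank I)) /=; last exact/onW_bij/enum_rank_bij.
by apply: eq_bigr => i _; rewrite !mxE !enum_rankK.
Qed.

Section Bidegree.
Variable K : comNzRingType.
Implicit Types P Q : {poly {poly K}}.

(** [a] bounds the degree in the inner variable [z], [b] the degree in the outer variable, for which
    [A] is substituted. *)
Definition bideg a b P :=
  forall i j, (a < i)%N || (b < j)%N -> P`_j`_i = 0.

Lemma bidegW a b a' b' P : (a <= a')%N -> (b <= b')%N ->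
  bideg a b P -> bideg a' b' P.
Proof.
by move=> aa bb dP i j ij; apply: dP; case/orP: ij => ?; apply/orP;
  [left|right]; lia.
Qed.

Lemma bideg0 a b : bideg a b 0.
Proof. by move=> i j _; rewrite !coef0. Qed.

Lemma bidegD a b P Q : bideg a b P -> bideg a b Q -> bideg a b (P + Q).
Proof. by move=> dP dQ i j ij; rewrite !coefD dP // dQ // addr0. Qed.

Lemma bidegN a b P : bideg a b P -> bideg a b (- P).
Proof. by move=> dP i j ij; rewrite !coefN dP // oppr0. Qed.

Lemma bideg_sum a b (I : Type) (r : seq I) (Q : pred I) F :
  (forall i, Q i -> bideg a b (F i)) -> bideg a b (\sum_(i <- r | Q i) F i).
Proof.
move=> dF; elim/big_ind: _ => //; [exact: bideg0 | exact: bidegD].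
Qed.

Lemma bidegMn a b P k : bideg a b P -> bideg a b (P *+ k).
Proof. by move=> dP i j ij; rewrite !coefMn dP // mul0rn. Qed.

Lemma bidegM a b a' b' P Q : bideg a b P -> bideg a' b' Q ->
  bideg (a + a') (b + b') (P * Q).
Proof.
move=> dP dQ i j ij; rewrite coefM coef_sum big1 // => k _.
rewrite coefM big1 // => l _.
have := ltn_ord k; have := ltn_ord l => li kj.
case: (boolP ((a < l)%N || (b < k)%N)) => [/dP ->|]; first by rewrite mul0r.
by move=> H; rewrite dQ ?mulr0 //; lia.
Qed.

Lemma bidegC (p : {poly K}) a : (size p <= a.+1)%N -> bideg a 0 p%:P.
Proof.
move=> sp i j ij; rewrite coefC; case: eqP ij => [-> | _ _]; last by rewrite coef0.
by rewrite orbF => ai; rewrite nth_default // (leq_trans sp).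
Qed.

Lemma bidegX : bideg 0 1 'X.
Proof.
move=> i j ij; rewrite coefX; case: eqP ij => [->|_ _]; last by rewrite coef0.
by rewrite orbF coef1; case: i.
Qed.

Lemma bideg1 : bideg 0 0 1.
Proof. by rewrite -polyC1; apply: bidegC; rewrite size_poly1. Qed.

Lemma bidegXn a b P n : bideg a b P -> bideg (n * a) (n * b) (P ^+ n).
Proof.
move=> dP; elim: n => [|n IHn]; first exact: bideg1.
by rewrite exprS !mulSn; apply: bidegM.
Qed.

Lemma bideg_prod a b n (F : 'I_n -> {poly {poly K}}) :
  (forall i, bideg a b (F i)) -> bideg (n * a) (n * b) (\prod_i F i).
Proof.
elim: n F => [|n IHn] F dF; first by rewrite big_ord0; exact: bideg1.
rewrite big_ord_recl !mulSn; apply: bidegM => //.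
by apply: IHn => i.
Qed.

Lemma bideg_deriv a b P : bideg a b P -> bideg a b P^`().
Proof.
move=> dP i j ij; rewrite coef_deriv coefMn dP ?mul0rn //.
by case/orP: ij => [->|bj] //; rewrite (ltn_trans bj) ?orbT.
Qed.

(* [z d/dz], where [z] is the variable of the coefficients. *)
Definition xderiv P := \poly_(j < size P) ('X * (P`_j)^`()).

Lemma coef_xderiv P j : (xderiv P)`_j = 'X * (P`_j)^`().
Proof.
rewrite coef_poly; case: ltnP => // Pj.
by rewrite nth_default // linear0 mulr0.
Qed.

Lemma bideg_xderiv a b P : bideg a b P -> bideg a b (xderiv P).
Proof.
move=> dP i j ij; rewrite coef_xderiv coefXM; case: i ij => //= i ij.
by rewrite coef_deriv dP ?mul0rn.
Qed.

Variable A : fps K.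

Definition psubst P : fps K := (map_poly (@fps_of_poly K) P).[A].
HB.instance Definition _ := GRing.RMorphism.copy psubst
  (horner_eval A \o map_poly (@fps_of_poly K)).

Lemma psubstC p : psubst p%:P = fps_of_poly p.
Proof. by rewrite /psubst map_polyC hornerC. Qed.

Lemma psubstX : psubst 'X = A.
Proof. by rewrite /psubst map_polyX hornerX. Qed.

Lemma psubstB P Q : psubst (P - Q) = psubst P - psubst Q.
Proof. exact: rmorphB. Qed.

Lemma psubstM P Q : psubst (P * Q) = psubst P * psubst Q.
Proof. exact: rmorphM. Qed.

Lemma psubstMn P k : psubst (P *+ k) = psubst P *+ k.
Proof. exact: rmorphMn. Qed.

Lemma psubstXn P k : psubst (P ^+ k) = psubst P ^+ k.
Proof. exact: rmorphXn. Qed.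

Lemma feuler_psubst P :
  feuler (psubst P) = psubst (xderiv P) + psubst P^`() * feuler A.
Proof.
elim/poly_ind: P => [|P c IHP].
  by rewrite /xderiv size_poly0 poly_def big_ord0 deriv0 rmorph0 mul0r addr0 raddf0.
have -> : xderiv (P * 'X + c%:P) = xderiv P * 'X + ('X * c^`())%:P.
  apply/polyP => j; rewrite coef_xderiv !coefD !coefMX !coefC coef_xderiv.
  by case: j => [|j] /=; rewrite !(add0r, addr0).
rewrite !(derivD, derivM, derivX, derivC) !(rmorphD, rmorphM) /=.
rewrite psubstX !psubstC raddfD /= feulerM IHP feuler_poly rmorph1 rmorph0 rmorphM /=.
by ring.
Qed.

(* Derivation along the algebraic curve [P = 0]. *)
Definition cderiv P Q := xderiv Q * P^`() - Q^`() * xderiv P.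

(** Differentiating [P(z, A) = 0] gives [P_y * z A' = - z P_z], which eliminates [feuler A] from the
    chain rule at the cost of a factor [P_y]. *)
Lemma psubst_cderiv P Q : psubst P = 0 ->
  psubst P^`() * feuler (psubst Q) = psubst (cderiv P Q).
Proof.
move=> P0; have := feuler_psubst P; rewrite P0 raddf0 => /esym/eqP.
rewrite addrC addr_eq0 => /eqP PA.
by rewrite feuler_psubst /cderiv rmorphB !rmorphM /= mulrDr mulrCA PA; ring.
Qed.

Lemma bideg_cderiv a b a' b' P Q : bideg a b P -> bideg a' b' Q ->
  bideg (a + a') (b + b') (cderiv P Q).
Proof.
move=> dP dQ; rewrite addnC [(b + _)%N]addnC; apply: bidegD.
  by apply: bidegM; [apply: bideg_xderiv | apply: bideg_deriv].
by apply/bidegN/bidegM; [apply: bideg_deriv | apply: bideg_xderiv].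
Qed.

End Bidegree.

(* Modulo [P], the dimension of the space of polynomials of bidegree at most
   [(a, b)] grows only linearly with [a] and [b]. *)
Lemma psubst_dependent (K : fieldType) (A : fps K) (P : {poly {poly K}})
    a0 b0 a b (I : finType) (G : I -> {poly {poly K}}) :
  P != 0 -> psubst A P = 0 -> bideg a0 b0 P -> (a0 <= a)%N -> (b0 <= b)%N ->
  (forall i, bideg a b (G i)) ->
  (a.+1 * b.+1 < #|I| + (a.+1 - a0) * (b.+1 - b0))%N ->
  exists2 c : I -> K, exists i, c i != 0 &
    \sum_i fps_of_poly (c i)%:P * psubst A (G i) = 0.
Proof.
move=> P0 PA dP aa bb dG card.
(* The [G i] are completed by the multiples of [P] by monomials; together they outnumber the
   monomials of bidegree at most [(a, b)]. *)
pose I' := ('I_(a.+1 - a0) * 'I_(b.+1 - b0))%type.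
pose F (i : I + I') : {poly {poly K}} :=
  match i with inl i => G i | inr (k, l) => P * (('X^k)%:P * 'X^l) end.
have dXX (kl : I') :
    bideg (a - a0) (b - b0) (('X^(kl.1) : {poly K})%:P * 'X^(kl.2)).
  have := ltn_ord kl.1; have := ltn_ord kl.2 => h1 h2.
  apply: (@bidegW _ (kl.1 + kl.2 * 0) (0 + kl.2 * 1)); try lia.
  apply: bidegM; last by apply: bidegXn; apply: bidegX.
  by apply: bidegC; rewrite size_polyXn.
have dF i : bideg a b (F i).
  case: i => [i|kl] /=; first exact: dG.
  have := bidegM dP (dXX kl); rewrite !subnKC //; by case: kl.
have [] := @more_unknowns_than_equations K (I + I')%type
   ('I_a.+1 * 'I_b.+1)%type (fun i st => (F i)`_st.2`_st.1).
  by rewrite card_sum !card_prod !card_ord.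
move=> c [i0 ci0] crel.
have FR : \sum_i (c i)%:P%:P * F i = 0.
  apply/polyP => t; apply/polyP => s; rewrite !coef_sum coef0 coef0.
  case: (boolP ((a < s)%N || (b < t)%N)) => [st|].
    by rewrite big1 // => i _; rewrite coefCM coefCM dF // mulr0.
  rewrite negb_or -!leqNgt => /andP[sa tb].
  have := crel (@Ordinal a.+1 s sa, @Ordinal b.+1 t tb) => /= H; rewrite -[RHS]H.
  by apply: eq_bigr => i _; rewrite !coefCM.
rewrite big_sumType /= in FR.
pose Q : {poly {poly K}} :=
  \sum_(kl : I') (c (inr kl))%:P%:P * (('X^(kl.1))%:P * 'X^(kl.2)).
have FQ : \sum_(kl : I') (c (inr kl))%:P%:P * (F (inr kl)) = P * Q.
  rewrite mulr_sumr; apply: eq_bigr => -[k l] _ /=; ring.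
rewrite FQ in FR.
exists (c \o inl) => /=; last first.
  have := congr1 (psubst A) FR; rewrite rmorphD rmorphM /= PA mul0r addr0.
  rewrite rmorph0 rmorph_sum /= => H; rewrite -[RHS]H.
  by apply: eq_bigr => i _; rewrite rmorphM /= psubstC.
(* A relation among the multiples of [P] alone reads [P * Q = 0], so [Q], and with it every
   coefficient of the relation, would vanish. *)
apply: contrapT => /forallNP cl0.
have {}cl0 i : c (inl i) = 0 by apply/eqP; apply: contrapT => /negP; exact: cl0.
move/eqP: FR; rewrite big1 ?add0r => [|i _]; last by rewrite cl0 !polyC0 mul0r.
rewrite mulf_eq0 (negPf P0) /= => /eqP Q0.
case: i0 ci0 => [i|[k l]]; first by rewrite cl0 eqxx.
have := congr1 (fun q : {poly {poly K}} => q`_l`_k) Q0.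
rewrite !coef_sum coef0 coef0 (bigD1 (k, l)) //= big1 => [|[k' l'] /= kl].
  by rewrite !coefCM coefXn eqxx mulr1 coefXn eqxx mulr1 addr0 => ->; rewrite eqxx.
rewrite !coefCM !coefXn; case: eqP => [ll|_]; last by rewrite mulr0 coef0 mulr0.
rewrite mulr1 coefXn; case: eqP => [kk|_]; last by rewrite mulr0.
by move: kl; rewrite -(val_inj ll) -(val_inj kk) eqxx.
Qed.

(** * Recurrences of an algebraic series *)

(* The recurrence with coefficients [p_i = \sum_e c i e 'X^e], applied to the
   coefficients of [A]. *)
Definition recop (K : comNzRingType) (L n : nat) (c : nat -> nat -> K)
    (A : fps K) : fps K :=
  \sum_(i < L.+1) \sum_(e < n)
    fps_of_poly (c i e)%:P * iter e (@feuler K) (fps_of_poly 'X^i * A).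

Lemma fcoef_recop (K : comNzRingType) L n c (A : fps K) k :
  fcoef (recop L n c A) k = \sum_(i < L.+1) \sum_(e < n)
    c i e * (k%:R ^+ e * (if (i <= k)%N then fcoef A (k - i) else 0)).
Proof.
rewrite fcoef_sum; apply: eq_bigr => i _; rewrite fcoef_sum.
by apply: eq_bigr => e _; rewrite fcoefZ fcoef_iter_feuler fcoefXnM.
Qed.

(* The counts below need [L.+1 * n] unknowns to outnumber a dimension of at most
   [(L + 2 n B + 1) B + (2 n B + 2) B], and the order of vanishing to exceed
   [(a + b) B^2 + B], where [(a, b) = (L + 2 n B, 2 n B + 1)] bounds the
   bidegrees of the numerators. *)
Definition rec_size B := B.+1.
Definition rec_order B := (4 * B ^ 3 + 4 * B ^ 2 + 2 * B)%N.
Definition rec_check B :=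
  ((rec_order B + 2 * rec_size B * B + (2 * rec_size B * B).+1) * B ^ 2 + B)%N.

Section Algebraic.
Variables (K : numFieldType) (A : fps K).

(** An equation of least degree in the outer variable works: its derivative is smaller and, in
    characteristic 0, nonzero, so it cannot vanish at [A]. *)
Lemma separable_equation B P : P != 0 -> psubst A P = 0 -> bideg B B P ->
  exists Q, [/\ Q != 0, psubst A Q = 0, bideg B B Q & psubst A Q^`() <> 0].
Proof.
move=> P0 PA dP.
pose good n := `[< exists Q, [/\ Q != 0, psubst A Q = 0, bideg B B Q &
  size Q = n] >].
have exn : exists n, good n by exists (size P); apply/asboolP; exists P.
case: (ex_minnP exn) => n /asboolP[Q [Q0 QA dQ sQ]] nmin.
exists Q; split=> // Q'A; have [Q'0|Q'0] := eqVneq Q^`() 0.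
  have sQ1 : (size Q <= 1)%N.
    rewrite leqNgt; apply/negP => sQ1.
    have := congr1 (fun q : {poly {poly K}} => q`_((size Q).-2)) Q'0.
    rewrite coef_deriv coef0 => /eqP; rewrite -mulr_natr mulf_eq0 => /orP[].
      rewrite (_ : (size Q).-2.+1 = (size Q).-1); last by lia.
      by rewrite -lead_coefE lead_coef_eq0 (negPf Q0).
    by rewrite -polyC_natr polyC_eq0 pnatr_eq0.
  (* A [Q] constant in the outer variable is its own value at [A], hence zero. *)
  case/negP: Q0; move: QA; rewrite (size1_polyC sQ1) psubstC => QA.
  suff -> : Q`_0 = 0 by rewrite polyC0.
  by apply/polyP => i; have := congr1 (fun f => fcoef f i) QA; rewrite coef0.
have /nmin : good (size Q^`()).
  by apply/asboolP; exists Q^`(); split=> //; apply: bideg_deriv.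
by rewrite -sQ leqNgt lt_size_deriv.
Qed.

(** * Fractions in [(z, A)] whose denominators are powers of [P_y] *)

Section Represented.
Variables (B : nat) (P : {poly {poly K}}).
Hypotheses (B0 : (0 < B)%N) (P0 : P != 0) (PA : psubst A P = 0).
Hypotheses (dP : bideg B B P) (P'A : psubst A P^`() <> 0).

Let D := psubst A P^`().

(** [f] is a fraction with denominator [D ^+ k], which is multiplied out because series do not form
    a field. *)
Definition represented k a b f := exists2 G, bideg a b G & D ^+ k * f = psubst A G.

(** The quotient rule: differentiating along the curve costs one factor [P_y], and differentiating
    the denominator another. *)
Lemma represented_feuler k a b f : represented k a b f ->
  represented k.+2 (a + 2 * B) (b + 2 * B) (feuler f).
Proof.
case=> G dG fG.
exists (P^`() * cderiv P G - (cderiv P P^`() * G) *+ k).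
  have dP' := bideg_deriv dP.
  apply: bidegD.
    by have := bidegM dP' (bideg_cderiv dP dG); apply: bidegW; lia.
  apply/bidegN/bidegMn.
  by have := bidegM (bideg_cderiv dP dP') dG; apply: bidegW; lia.
(* The power rule, multiplied by [D] to avoid the exponent [k - 1]. *)
have DX : D * feuler (D ^+ k) = (D ^+ k * feuler D) *+ k.
  elim: (k) => [|l IHl].
    rewrite expr0 mulr0n; have -> : feuler 1 = 0 :> fps K.
      have -> : 1 = fps_of_poly 1 :> fps K by rewrite rmorph1.
      by rewrite feuler_poly -polyC1 derivC mulr0 rmorph0.
    by rewrite mulr0.
  rewrite exprS feulerM mulrDr [D * (D * _)]mulrA.
  by rewrite -[D * D * _]mulrA IHl; ring.
have := psubst_cderiv G PA; have := psubst_cderiv P^`() PA.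
rewrite -/D => cP' cG.
rewrite psubstB psubstMn !psubstM -/D -cG -cP'.
rewrite -fG feulerM.
rewrite !mulrDr [D * (D * (feuler _ * f))]mulrA.
have -> : D * D * (feuler (D ^+ k) * f) = D * (D * feuler (D ^+ k)) * f.
  by ring.
by rewrite DX !exprS; ring.
Qed.

Lemma representedW k l a b f : represented k a b f ->
  represented (k + l) (a + l * B) (b + l * B) f.
Proof.
case=> G dG fG; exists (G * P^`() ^+ l).
  by apply: bidegM => //; apply/bidegXn/bideg_deriv.
by rewrite psubstM psubstXn -fG exprD; ring.
Qed.

Lemma represented_iter_feuler i e :
  represented (2 * e) (i + 2 * e * B) (1 + 2 * e * B)
    (iter e (@feuler K) (fps_of_poly 'X^i * A)).
Proof.
elim: e => [|e IHe].
  exists (('X^i)%:P * 'X).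
    apply: (@bidegW _ (i + 0) (0 + 1)); try lia.
    by apply: bidegM; [apply: bidegC; rewrite size_polyXn | apply: bidegX].
  by rewrite muln0 expr0 mul1r psubstM psubstC psubstX.
rewrite iterS; have := represented_feuler IHe.
have -> : (2 * e).+2 = (2 * e.+1)%N by lia.
by case=> G dG fG; exists G => //; apply: bidegW dG; lia.
Qed.

Let n := rec_size B.
Let L := rec_order B.
Let a := (L + 2 * n * B)%N.
Let b := (2 * n * B).+1.

Lemma represented_term i e : (i <= L)%N -> (e <= n)%N ->
  represented (2 * n) a b (iter e (@feuler K) (fps_of_poly 'X^i * A)).
Proof.
move=> iL en; have := representedW (2 * (n - e)) (represented_iter_feuler i e).
rewrite -mulnDr subnKC // => -[G dG fG]; exists G => //; move: dG.
have e2 : (2 * e * B + 2 * (n - e) * B = 2 * n * B)%N.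
  by rewrite -mulnDl -mulnDr subnKC.
by apply: bidegW; rewrite /a /b; lia.
Qed.

Lemma represented_terms : exists G : 'I_L.+1 -> 'I_n -> {poly {poly K}},
  forall i e, bideg a b (G i e) /\
    D ^+ (2 * n) * iter e (@feuler K) (fps_of_poly 'X^i * A) = psubst A (G i e).
Proof.
have rep (i : 'I_L.+1) (e : 'I_n) :=
  cid2 (@represented_term i e (ltn_ord i) (ltnW (ltn_ord e))).
exists (fun i e => s2val (rep i e)) => i e.
by split; [exact: (s2valP (rep i e)) | exact: (s2valP' (rep i e))].
Qed.

Lemma represented_recop c : represented (2 * n) a b (recop L n c A).
Proof.
have [G HG] := represented_terms.
exists (\sum_(i < L.+1) \sum_(e < n) (c i e)%:P%:P * G i e).
  apply: bideg_sum => i _; apply: bideg_sum => e _.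
  apply: (@bidegW _ (0 + a) (0 + b)) => //; apply: bidegM; last exact: (HG i e).1.
  by apply: bidegC; apply: leq_trans (size_polyC_leq1 _) _.
rewrite rmorph_sum mulr_sumr /=; apply: eq_bigr => i _.
rewrite rmorph_sum mulr_sumr /=; apply: eq_bigr => e _.
by rewrite psubstM psubstC -(HG i e).2 mulrCA.
Qed.

(** The [L.+1 * n] numerators are too many to be independent modulo [P]. The common denominator is
    then cancelled from their relation. *)
Lemma recop_exists : exists2 c : nat -> nat -> K,
  exists i e, [/\ (i <= L)%N, (e < n)%N & c i e != 0] & recop L n c A = 0.
Proof.
have [G HG] := represented_terms.
have [] := @psubst_dependent K A P B B a b ('I_L.+1 * 'I_n)%type
  (fun ie => G ie.1 ie.2) P0 PA dP.
- by rewrite /a /n /rec_size; nia.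
- by rewrite /b /n /rec_size; nia.
- by move=> [i e]; apply: (HG i e).1.
- rewrite card_prod !card_ord /a /b /n /L /rec_order /rec_size.
  have -> : ((4 * B ^ 3 + 4 * B ^ 2 + 2 * B + 2 * B.+1 * B).+1 - B = 
    4 * B ^ 3 + 4 * B ^ 2 + B + 2 * B.+1 * B + 1)%N by lia.
  have -> : ((2 * B.+1 * B).+2 - B = 2 * B * B + B + 2)%N by nia.
  by rewrite !expnS expn0; nia.
move=> c [[i0 e0] c0] crel.
pose c' i e := if insub i is Some i' then
  if insub e is Some e' then c (i' : 'I_L.+1, e' : 'I_n) else 0 else 0.
have c'E (i : 'I_L.+1) (e : 'I_n) : c' i e = c (i, e) by rewrite /c' !valK.
exists c'.
  exists i0, e0; split; rewrite ?c'E //; first by rewrite -ltnS.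
have DR : D ^+ (2 * n) * recop L n c' A = 0.
  rewrite -[RHS]crel mulr_sumr (eq_bigr (fun i => \sum_(e < n)
    fps_of_poly (c (i, e))%:P * psubst A (G i e))).
    rewrite pair_big /=; apply: eq_bigr => -[i e] _ //.
  move=> i _; rewrite mulr_sumr; apply: eq_bigr => e _.
  by rewrite c'E mulrCA (HG i e).2.
by case: (fps_mul_eq0 DR) => // /(fps_expf_neq0 P'A).
Qed.

(** Modulo [P] the products [z^j g^i] with [i <= B] and [j <= E] are dependent, which gives an
    equation for [g] with coefficients of degree at most [E]. The lowest nonzero one is a multiple
    of [g], so it vanishes to an order above its degree. *)
Lemma recop_low c :
  (forall k, (k <= rec_check B)%N -> fcoef (recop L n c A) k = 0) ->
  recop L n c A = 0.
Proof.
set h := recop _ _ _ _; set E := rec_check B => hlow.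
have [G dG hG] := represented_recop c; rewrite -/h in hG.
set g := D ^+ _ * h in hG.
have glow k : (k <= E)%N -> fcoef g k = 0.
  by rewrite /g mulrC; apply: fcoefM_high.
apply: contrapT => h0.
have g0 : g <> 0.
  by move=> /fps_mul_eq0[] // /(fps_expf_neq0 P'A).
have [] := @psubst_dependent K A P B B (E + B * a) (B * b) ('I_B.+1 * 'I_E.+1)%type
  (fun ij => ('X^(ij.2))%:P * G ^+ ij.1) P0 PA dP.
- by rewrite /a /n /rec_size; nia.
- by rewrite /b /n /rec_size; nia.
- move=> [i j] /=; have := ltn_ord i; have := ltn_ord j => jE iB.
  apply: (@bidegW _ (j + i * a) (0 + i * b)); try by nia.
  by apply: bidegM; [apply: bidegC; rewrite size_polyXn | apply: bidegXn].
- rewrite card_prod !card_ord.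
  (* The value of [rec_check] is made for this count. Below, [d] stands for [B * b - B], which
     avoids truncated subtraction. *)
  have -> : E = ((a + b) * B ^ 2 + B)%N by [].
  rewrite !expnS expn0 muln1.
  have [d bB] : exists d, (B * b = d + B)%N.
    by exists (2 * n * B * B)%N; rewrite /b mulnS addnC mulnC.
  have key : (B * (B * a) + B * d <= (a + b) * (B * B))%N.
    have : (B * d <= B * (B * b))%N by rewrite leq_mul2l bB leq_addr orbT.
    by rewrite mulnDl; lia.
  rewrite bB; move: ((a + b) * (B * B))%N (B * a)%N key => x y key.
  have -> : ((x + B + y).+1 - B = x + y + 1)%N by lia.
  have -> : ((d + B).+1 - B = d.+1)%N by lia.
  lia.
move=> q [[i0 j0] q0] qrel.
pose p (i : nat) : {poly K} := \poly_(j < E.+1)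
  (if insub i is Some i' then q (i' : 'I_B.+1, inord j) else 0).
have pE (i : 'I_B.+1) : p i = \poly_(j < E.+1) q (i, inord j).
  by apply/polyP => j; rewrite !coef_poly valK.
have prel : \sum_(i < B.+1) fps_of_poly (p i) * g ^+ i = 0.
  rewrite -[RHS]qrel; transitivity (\sum_(i < B.+1) \sum_(j < E.+1)
      fps_of_poly (q (i, j))%:P * psubst A (('X^j)%:P * G ^+ i)).
    apply: eq_bigr => i _; rewrite pE poly_def rmorph_sum mulr_suml /=.
    apply: eq_bigr => j _; rewrite psubstM psubstXn psubstC hG.
    by rewrite inord_val -mul_polyC rmorphM mulrA.
  by rewrite pair_big /=; apply: eq_bigr => -[i j].
have exi : exists i, (p i != 0) && (i < B.+1)%N.
  exists i0; rewrite ltn_ord andbT; apply: contraNneq q0 => pi0.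
  have := congr1 (fun r : {poly K} => r`_j0) pi0.
  by rewrite coef0 pE coef_poly ltn_ord inord_val => ->.
case: (ex_minnP exi) => i1 /andP[p1 i1B] i1min.
(* Dividing by [g ^+ i1], the smallest power of [g] that occurs, shows that
   [p i1] is a multiple of [g]. *)
set s := \sum_(i < B.+1 | (i1 < i)%N) fps_of_poly (p i) * g ^+ (i - i1.+1).
have : g ^+ i1 * (fps_of_poly (p i1) + g * s) = 0.
  rewrite -[RHS]prel.
  rewrite mulrDr [RHS](bigID (fun i : 'I_B.+1 => (i < i1)%N)) /=.
  rewrite [X in _ = X + _]big1 ?add0r => [|i ii]; last first.
    have [-> |pi] := eqVneq (p i) 0; first by rewrite rmorph0 mul0r.
    by have := i1min i; rewrite pi ltn_ord /= leqNgt ii => /(_ isT).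
  rewrite (bigD1 (Ordinal i1B)) /= ?ltnn // [X in X + _]mulrC; congr (_ + _).
  rewrite /s !mulr_sumr; apply: eq_big => [i|i ii].
    by rewrite -val_eqE /=; lia.
  have -> : g ^+ i = g ^+ i1 * (g * g ^+ (i - i1.+1)).
    by rewrite -exprS -exprD; congr (_ ^+ _); lia.
  by ring.
case/fps_mul_eq0 => [/(fps_expf_neq0 g0) //|].
move/eqP; rewrite addr_eq0 => /eqP p1g.
(* Up to index [E] the coefficients vanish because [g] is a factor, beyond [E] because of the
   degree. *)
case/negP: p1; apply/eqP/polyP => k; rewrite coef0.
case: (ltnP k E.+1) => kE; last by rewrite coef_poly ltnNge kE.
by rewrite -fcoef_poly p1g fcoefN (fcoefM_high _ glow) ?oppr0.
Qed.

End Represented.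
End Algebraic.

(** * The algebraic equation *)

(** Right multiplication by the unipotent matrix [U] forms partial sums of columns. The result is
    lower triangular, with diagonal 1 except for the last entry. *)
Lemma det_sub_companion (K : comNzRingType) m (w : 'I_m.+1 -> K) :
  \det (1%:M - \matrix_(i, j) (if i == ord_max then w j else (i.+1 == j)%:R)) =
  1 - \sum_j w j.
Proof.
set C := \matrix_(i, j) _.
pose U : 'M[K]_m.+1 := \matrix_(i, j) (i <= j)%N%:R.
have detU : \det U = 1.
  rewrite -det_tr det_trig; last by
    apply/is_trig_mxP => i j ij; rewrite !mxE leqNgt ij.
  by rewrite big1 // => i _; rewrite !mxE leqnn.
have CU i j : ((1%:M - C) *m U) i j = if i == ord_max
    then (j == ord_max)%:R - \sum_(k < m.+1 | (k <= j)%N) w k else (i == j)%:R.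
  rewrite mulmxBl mul1mx !mxE; case: eqP => [->|/eqP im].
    congr (_ - _); first by congr (_%:R); rewrite -val_eqE /=; have := ltn_ord j; lia.
    rewrite [RHS]big_mkcond; apply: eq_bigr => k _; rewrite !mxE eqxx.
    by case: (k <= j)%N; rewrite ?mulr1 ?mulr0.
  have iS : (i.+1 < m.+1)%N.
    by have := ltn_ord i; move: im; rewrite -val_eqE /=; lia.
  rewrite (bigD1 (Ordinal iS)) //= big1 => [|k ki].
    rewrite !mxE (negPf im) eqxx mul1r addr0 -val_eqE /=.
    by case: ltngtP; rewrite ?subr0 ?subrr.
  rewrite !mxE (negPf im) (_ : (_ == _) = false) ?mul0r //.
  by apply/negbTE; move: ki; rewrite -val_eqE eq_sym.
have <- : \det ((1%:M - C) *m U) = \det (1%:M - C) by rewrite det_mulmx detU mulr1.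
rewrite det_trig; last first.
  apply/is_trig_mxP => i j ij; rewrite CU.
  have -> : (i == ord_max) = false.
    by rewrite -val_eqE /=; have := ltn_ord j; lia.
  by rewrite -val_eqE /= ltn_eqF.
rewrite (bigD1 ord_max) //= big1 => [|i im]; last by rewrite CU (negPf im) eqxx.
rewrite CU eqxx mulr1; congr (1 - _); apply: eq_bigl => k.
by rewrite -ltnS ltn_ord.
Qed.

(** Multilinearity in the rows. Since [J'] runs over all maps, and not only the increasing ones of
    Cauchy-Binet, the coefficients are entries of a tensor power of [T]. *)
Lemma det_rowsub_mul (K : comNzRingType) m N (T : 'M[K]_N) (V : 'M[K]_(N, m))
    (J : {ffun 'I_m -> 'I_N}) :
  \det (rowsub J (T *m V)) =
  \sum_(J' : {ffun 'I_m -> 'I_N}) (\prod_k T (J k) (J' k)) * \det (rowsub J' V).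
Proof.
rewrite /determinant; under [RHS]eq_bigr do rewrite mulr_sumr.
rewrite exchange_big /=; apply: eq_bigr => s _.
under eq_bigr do rewrite !mxE.
rewrite bigA_distr_bigA mulr_sumr /=; apply: eq_bigr => J' _.
by rewrite big_split mulrCA /=; congr (_ * (_ * _)); apply: eq_bigr => k _; rewrite mxE.
Qed.

(** * First passage series of the walk *)

Section Walk.
Variables (K : comNzRingType) (r : nat) (s : 'I_r -> int) (q : 'I_r -> K).

(* Expectation of [g] at the landing point, on the event that the walk started
   at [x] becomes positive after exactly [n] steps. *)
Fixpoint walk (g : int -> K) (n : nat) (x : int) : K :=
  if n is n'.+1 then
    if x <= 0 then \sum_j q j * walk g n' (x + s j) else 0
  else if 0 < x then g x else 0.

Definition wser g x : fps K := Fps (fun n => walk g n x).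

Lemma wser_gt0 g x : 0 < x -> wser g x = fps_of_poly (g x)%:P.
Proof.
by move=> x0; apply: fpsP => -[|n] /=; rewrite coefC ?x0 //= leNgt x0.
Qed.

Definition wstep (f : int -> fps K) x :=
  fps_of_poly 'X * \sum_j fps_of_poly (q j)%:P * f (x + s j).

Lemma wser_le0 g x : x <= 0 -> wser g x = wstep (wser g) x.
Proof.
move=> x0; apply: fpsP => n; rewrite fcoefXM; case: n => [|n] /=.
  by rewrite ltNge x0.
by rewrite x0 fcoef_sum; apply: eq_bigr => j _; rewrite fcoefZ.
Qed.

Variable m : nat.
Hypothesis sm : forall j, (`|s j| <= m)%N.

(** [wstep] carries a factor [z], so a coefficient at [x <= 0] depends only on the preceding
    coefficients at points [x + s j], which are again at most [m]. *)
Lemma wstep_unique (f1 f2 : int -> fps K) :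
  (forall x, 0 < x <= m%:Z -> f1 x = f2 x) ->
  (forall x, x <= 0 -> f1 x = wstep f1 x) ->
  (forall x, x <= 0 -> f2 x = wstep f2 x) ->
  forall x, x <= m%:Z -> f1 x = f2 x.
Proof.
move=> fpos f1E f2E x xm; apply: fpsP => n; elim: n x xm => [|n IHn] x xm.
  case: (ltP 0 x) => x0; first by rewrite fpos // x0.
  by rewrite f1E // f2E // !fcoefXM.
case: (ltP 0 x) => x0; first by rewrite fpos // x0.
rewrite f1E // f2E // !fcoefXM !fcoef_sum; apply: eq_bigr => j _.
by rewrite !fcoefZ IHn //; have := sm j; lia.
Qed.

(** Walks started at [m] or below land in [1..m]; landing points are counted downwards from [m]. *)
Definition delta (c : nat) (x : int) : K := (x == m%:Z - c%:Z)%:R.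

Lemma wser_delta_gt0 (c : 'I_m) x : 0 < x <= m%:Z ->
  wser (delta c) x = (c == `|m%:Z - x|%N :> nat)%:R.
Proof.
move=> /andP[x0 xm]; rewrite wser_gt0 // /delta rmorph_nat rmorph_nat.
by congr (_%:R); have := ltn_ord c; lia.
Qed.

Lemma sum_delta (F : nat -> fps K) x : 0 < x <= m%:Z ->
  \sum_(c < m) wser (delta c) x * F c = F `|m%:Z - x|%N.
Proof.
move=> xm; have cm : (`|m%:Z - x|%N < m)%N by lia.
rewrite (bigD1 (Ordinal cm)) //= big1 => [|c cc].
  by rewrite (wser_delta_gt0 (Ordinal cm)) // eqxx mul1r addr0.
by rewrite wser_delta_gt0 // (_ : (_ == _) = false) ?mul0r //; apply/negbTE.
Qed.

Lemma wstepMr (f : int -> fps K) (h : fps K) x :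
  wstep f x * h = wstep (fun y => f y * h) x.
Proof.
rewrite /wstep -mulrA mulr_suml; congr (_ * _); apply: eq_bigr => j _.
by rewrite mulrA.
Qed.

Lemma wstep_sum (I : finType) (f : I -> int -> fps K) x :
  \sum_i wstep (f i) x = wstep (fun y => \sum_i f i y) x.
Proof.
rewrite /wstep -mulr_sumr exchange_big; congr (_ * _); apply: eq_bigr => j _.
by rewrite mulr_sumr.
Qed.

(* The walk from [x - 1] shadows the walk from [x] until the latter lands at
   [m - c], and then goes on from [m - c - 1]. *)
Lemma wser_shift g x : x <= m%:Z ->
  wser g (x - 1) = \sum_(c < m) wser (delta c) x * wser g (m%:Z - c.+1%:Z).
Proof.
apply: (@wstep_unique (fun x => wser g (x - 1))
  (fun x => \sum_(c < m) wser (delta c) x * wser g (m%:Z - c.+1%:Z))).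
- move=> y ym; rewrite (@sum_delta (fun c => wser g (m%:Z - c.+1%:Z)) y ym).
  by congr wser; lia.
- move=> y y0; rewrite wser_le0; last by lia.
  by congr (_ * _); apply: eq_bigr => j _; congr (_ * wser _ _); lia.
- move=> y y0; rewrite -wstep_sum; apply: eq_bigr => c _.
  by rewrite wser_le0 // wstepMr.
Qed.

Lemma wser_total x : x <= m%:Z ->
  wser (fun=> 1) x = \sum_(c < m) wser (delta c) x.
Proof.
apply: (@wstep_unique _ (fun x => \sum_(c < m) wser (delta c) x)).
- move=> y ym; case/andP: (ym) => y0 _; rewrite wser_gt0 // polyC1 rmorph1.
  have := @sum_delta (fun=> 1) y ym => <-.
  by apply: eq_bigr => c _; rewrite mulr1.
- exact: wser_le0.
- by move=> y y0; rewrite -wstep_sum; apply: eq_bigr => c _; rewrite wser_le0.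
Qed.

End Walk.

Lemma det_psubst (K : comNzRingType) (A : fps K) n (M : 'M[{poly {poly K}}]_n) :
  psubst A (\det M) = \det (map_mx (psubst A) M).
Proof. by rewrite det_map_mx. Qed.

(** * Elimination by means of the kernel recurrence and minors *)

Section Equation.
Variables (K : fieldType) (r : nat) (s : 'I_r -> int) (q : 'I_r -> K) (m : nat).
Hypothesis sm : forall j, (`|s j| <= m.+1)%N.

(** The bound on the faces is written [m.+1] so that [C] has a last row. Rows [t < m.+1] start at
    positive capital and are unit vectors; row [m.+1] starts at 0. *)
Let V t c : fps K := wser s q (delta K m.+1 c) (m.+1%:Z - t%:Z).
Let C : 'M[fps K]_m.+1 := \matrix_(i, j) V i.+1 j.

Lemma V_low t c : (t < m.+1)%N -> (c < m.+1)%N -> V t c = (t == c)%:R.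
Proof.
move=> tm cm; rewrite /V (@wser_delta_gt0 _ _ _ _ _ (Ordinal cm)) /=; last by lia.
by congr (_%:R); lia.
Qed.

Lemma V_succ t c : V t.+1 c = \sum_(i < m.+1) V t i * V i.+1 c.
Proof.
rewrite /V (_ : m.+1%:Z - t.+1%:Z = m.+1%:Z - t%:Z - 1); last by lia.
by rewrite (wser_shift q sm) //; lia.
Qed.

Lemma det_1_sub_C : \det (1%:M - C) = 1 - wser s q (fun=> 1) 0.
Proof.
rewrite (wser_total q sm) // -det_sub_companion; congr (\det (_ - _)).
apply/matrixP => i j; rewrite !mxE; case: eqP => [->|/eqP im].
  by rewrite /V /= subrr.
rewrite V_low //; have := ltn_ord i; move: im; rewrite -val_eqE /=; lia.
Qed.

(** The kernel of the walk: with ['X^t] standing for [V t], it encodes the first step from capital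
    0. Each [m.+1 - s j] is nonnegative, so the absolute value changes nothing. *)
Let kpoly : {poly {poly K}} :=
  'X^(m.+1) - \sum_j ('X * (q j)%:P)%:P * 'X^(`|m.+1%:Z - s j|%N).

Lemma kpoly_V c n : (size kpoly <= n)%N ->
  \sum_(t < n) fps_of_poly kpoly`_t * V t c = 0.
Proof.
(* A range that contains every exponent in [kpoly], so that its monomials can be evaluated
   separately. *)
pose n' := maxn n (2 * m.+1).+1.
have n'mono (k : {poly {poly K}}) : (size k <= n)%N ->
    \sum_(t < n) fps_of_poly k`_t * V t c = \sum_(t < n') fps_of_poly k`_t * V t c.
  move=> kn; rewrite (big_ord_widen n' (fun t => fps_of_poly k`_t * V t c)) ?leq_maxl //.
  rewrite big_mkcond; apply: eq_bigr => t _; case: ltnP => // nt.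
  by rewrite nth_default ?rmorph0 ?mul0r // (leq_trans kn).
have coefXn_sum (d : nat) : (d <= 2 * m.+1)%N ->
    \sum_(t < n') fps_of_poly ('X^d : {poly {poly K}})`_t * V t c = V d c.
  move=> dm; have dn : (d < n')%N by rewrite leq_max; apply/orP; right; lia.
  rewrite (bigD1 (Ordinal dn)) //= coefXn eqxx rmorph1 mul1r big1 ?addr0 // => t td.
  rewrite coefXn (_ : (_ == _) = false) ?rmorph0 ?mul0r //; exact/negbTE.
move=> /n'mono ->.
transitivity (V m.+1 c - \sum_j fps_of_poly ('X * (q j)%:P) * V `|m.+1%:Z - s j|%N c).
  rewrite -[V m.+1 c]coefXn_sum; last by lia.
  rewrite (eq_bigr (fun j : 'I_r => \sum_(t < n') fps_of_poly ('X * (q j)%:P) *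
    (fps_of_poly ('X^(`|m.+1%:Z - s j|%N) : {poly {poly K}})`_t * V t c))); last first.
    by move=> j _; rewrite -mulr_sumr coefXn_sum //; have := sm j; lia.
  rewrite exchange_big -sumrB; apply: eq_bigr => t _.
  rewrite coefB coef_sum rmorphB rmorph_sum mulrBl mulr_suml /=.
  by congr (_ - _); apply: eq_bigr => j _; rewrite coefCM rmorphM mulrA.
rewrite {1}/V subrr wser_le0 // /wstep mulr_sumr -sumrB big1 // => j _.
rewrite rmorphM mulrA /V add0r; apply/eqP; rewrite subr_eq0; apply/eqP.
by congr (_ * wser _ _ _ _); have := sm j; lia.
Qed.

(** At [z = 0] only ['X^(m.+1)] remains. *)
Lemma kpoly_neq0 : kpoly`_m.+1 != 0.
Proof.
apply/eqP => /(congr1 (fun p : {poly K} => p`_0)).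
rewrite coefB coefXn eqxx coefB coef1 coef_sum coef_sum coef0 big1 ?subr0.
  by move/eqP; rewrite oner_eq0.
move=> j _; rewrite coefCM coefXn -mulrA coefXM //.
Qed.

Lemma kpoly_size1 t : (size (kpoly`_t)%R <= 2)%N.
Proof.
rewrite coefB coef_sum; apply: leq_trans (size_polyD _ _) _.
rewrite geq_max size_polyN; apply/andP; split.
  by rewrite coefXn; case: (_ == _); rewrite ?size_poly1 ?size_poly0.
apply: leq_trans (size_sum _ _ _) _; apply/bigmax_leqP => j _.
rewrite coefCM coefXn; case: (_ == _); last by rewrite mulr0 size_poly0.
rewrite mulr1; apply: leq_trans (size_polyMleq _ _) _; rewrite size_polyX.
by rewrite addSn add1n ltnS size_polyC_leq1.
Qed.

Let N := (size kpoly).-1.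
Let ell := lead_coef kpoly.

Lemma size_kpoly : (m.+1 <= N <= 2 * m.+1)%N.
Proof.
have mN : (m.+1 < size kpoly)%N.
  by rewrite ltnNge; apply/negP => /(nth_default 0)/eqP; exact/negP/kpoly_neq0.
apply/andP; split; first by rewrite /N; lia.
suff : (size kpoly <= (2 * m.+1).+1)%N by rewrite /N; lia.
apply: leq_trans (size_polyD _ _) _; rewrite geq_max size_polyN size_polyXn.
apply/andP; split; first by lia.
apply: leq_trans (size_sum _ _ _) _; apply/bigmax_leqP => j _.
apply: leq_trans (size_polyMleq _ _) _; rewrite size_polyXn.
have := size_polyC_leq1 ('X * (q j)%:P : {poly K}).
by have := sm j; case: (size _) => [|[|]] //=; lia.
Qed.

Let Vm : 'M[fps K]_(N, m.+1) := \matrix_(t, c) V t c.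
Let Tm : 'M[{poly K}]_N := \matrix_(t, t')
  ((t == t')%:R * ell +
    (if t.+1 == N then kpoly`_t' else - ((t.+1 == t')%:R * ell))).

(** Row [t] of [Vm *m C] is [V t.+1], the next row of [Vm] except at the end, where [kpoly_V]
    rewrites [ell * V N]. The factor [ell] keeps the entries of [Tm] polynomial. *)
Lemma Tm_V :
  map_mx (@fps_of_poly K) Tm *m Vm = fps_of_poly ell *: (Vm *m (1%:M - C)).
Proof.
apply/matrixP => t c; rewrite mulmxBr mulmx1 !mxE.
under [in RHS]eq_bigr => i _ do rewrite !mxE.
rewrite -V_succ.
under eq_bigr => i _ do rewrite !mxE rmorphD mulrDl.
rewrite big_split /= mulrBr; congr (_ + _).
  rewrite (bigD1 t) //= eqxx mul1r big1 ?addr0 // => i it.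
  by rewrite eq_sym (negPf it) mul0r rmorph0 mul0r.
case: eqP => [tN|/eqP tN].
  have := @kpoly_V c N.+1 (leqSpred _).
  rewrite big_ord_recr /= -lead_coefE -/ell => /eqP; rewrite addr_eq0 => /eqP ->.
  by rewrite tN.
have tN' : (t.+1 < N)%N by have := ltn_ord t; lia.
rewrite (bigD1 (Ordinal tN')) //= eqxx mul1r rmorphN mulNr big1 ?addr0 // => i it.
rewrite (_ : (_ == _) = false) ?mul0r ?rmorphN ?rmorph0 ?mulNr ?mul0r ?oppr0 //.
by apply/negbTE; move: it; rewrite -val_eqE eq_sym.
Qed.

Let n := #|{ffun 'I_m.+1 -> 'I_N}|.
Let w : 'cV[fps K]_n := \col_a \det (rowsub (enum_val a : {ffun _ -> _}) Vm).
(** The [m.+1]-st tensor power of [Tm], indexed by maps as the minors in [w] are. *)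
Let T : 'M[{poly K}]_n := \matrix_(a, b)
  \prod_k Tm ((enum_val a : {ffun _ -> _}) k) ((enum_val b : {ffun _ -> _}) k).
Let y : {poly {poly K}} := (ell ^+ m.+1)%:P * (1 - 'X).
Let A := wser s q (fun=> 1) 0.

(** The minors of [Tm *m Vm] are computed twice: by multilinearity they are [T] applied to those of
    [Vm], and by [Tm_V] they are those of [Vm] times a determinant, the value of [y] at [A]. *)
Lemma T_w : map_mx (@fps_of_poly K) T *m w = psubst A y *: w.
Proof.
apply/matrixP => a j; rewrite ord1 {j} !mxE.
set J := enum_val a.
have -> : psubst A y = \det (fps_of_poly ell *: (1%:M - C)).
  rewrite detZ det_1_sub_C psubstM psubstC psubstB psubstX rmorphXn.
  by congr (_ * (_ - _)); rewrite -polyC1 psubstC rmorph1.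
rewrite mulrC -det_mulmx.
have -> : rowsub J Vm *m (fps_of_poly ell *: (1%:M - C)) =
    rowsub J (map_mx (@fps_of_poly K) Tm *m Vm).
  by rewrite Tm_V mul_rowsub_mx scalemxAr.
rewrite det_rowsub_mul [RHS](reindex (fun b : 'I_n => enum_val b)) /=;
  last exact/onW_bij/enum_val_bij.
apply: eq_bigr => b _; rewrite !mxE rmorph_prod; congr (_ * _).
by apply: eq_bigr => k _; rewrite [RHS]mxE.
Qed.

Lemma algebraic_equation : exists P : {poly {poly K}},
  [/\ P != 0, psubst A P = 0 &
      bideg (m.+1 * (2 * m.+1) ^ m.+1) (m.+1 * (2 * m.+1) ^ m.+1) P].
Proof.
have /andP[mN Nm] := size_kpoly.
pose P := \det (y%:M - map_mx polyC T).
exists P; split.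
(* The characteristic polynomial is monic and [y] has degree 1 in the outer variable, so the
   composition is nonzero. *)
- have -> : P = char_poly T \Po y.
    rewrite /char_poly -[RHS]/((comp_poly y) _) -det_map_mx; congr (\det _).
    rewrite /char_poly_mx map_mxB map_scalar_mx /= comp_polyX; congr (_ - _).
    by apply/matrixP => i j; rewrite !mxE comp_polyC.
  rewrite -size_poly_gt0 size_comp_poly2; first by rewrite size_char_poly.
  rewrite size_Cmul; last first.
    rewrite expf_neq0 // lead_coef_eq0; apply: contraTneq mN => k0.
    by rewrite /N k0 size_poly0.
  by rewrite -size_polyN opprB -polyC1 size_XsubC.
(* The first [m.+1] rows of [Vm] form the identity, so [w] has an entry 1, and multiplying
   [Th *m w = 0] by the adjugate yields [\det Th = 0]. *)
- pose J0 : {ffun 'I_m.+1 -> 'I_N} := [ffun i => widen_ord mN i].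
  have w0 : w (enum_rank J0) 0 = 1.
    rewrite mxE enum_rankK (_ : rowsub _ _ = 1%:M) ?det1 //.
    by apply/matrixP => i j; rewrite !mxE ffunE V_low //=.
  pose Th := map_mx (psubst A) (y%:M - map_mx polyC T).
  have detTh : psubst A P = \det Th := det_psubst A _.
  have Thw : Th *m w = 0.
    rewrite /Th map_mxB map_scalar_mx mulmxBl mul_scalar_mx /=.
    rewrite -T_w; apply/eqP; rewrite subr_eq0; apply/eqP; congr (_ *m _).
    by apply/matrixP => i j; rewrite !mxE psubstC.
  have : \adj Th *m (Th *m w) = 0 by rewrite Thw mulmx0.
  rewrite mulmxA mul_adj_mx mul_scalar_mx => /matrixP/(_ (enum_rank J0) 0).
  by rewrite mxE w0 mulr1 [RHS]mxE detTh.
(* Entries have bidegree at most [(m.+1, 1)], and the matrix has size [N ^ m.+1] with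
   [N <= 2 * m.+1]. *)
have dell : bideg 1 0 (ell%:P).
  by apply: bidegC; apply: kpoly_size1.
have sT (a b : 'I_n) : bideg m.+1 0 (T a b)%:P.
  rewrite mxE rmorph_prod /=.
  rewrite -[X in bideg X]muln1 -[X in bideg _ X](muln0 m.+1).
  apply: bideg_prod => k; rewrite mxE rmorphD rmorphM /=.
  apply: bidegD.
    rewrite rmorph_nat mulr_natl; exact: bidegMn.
  case: ifP => _; first by apply/bidegC/kpoly_size1.
  by rewrite rmorphN rmorphM rmorph_nat mulr_natl; apply/bidegN/bidegMn.
have dTh a b : bideg m.+1 1 ((y%:M - map_mx polyC T) a b).
  have -> : (y%:M - map_mx polyC T) a b = y *+ (a == b) - (T a b)%:P.
    by rewrite [LHS]mxE [X in X + _]mxE [X in _ + X]mxE [X in - X]mxE.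
  apply: bidegD; last by apply/bidegN; apply: bidegW (sT a b).
  apply/bidegMn; rewrite /y rmorphXn /=.
  apply: (@bidegW _ (m.+1 * 1 + 0) (m.+1 * 0 + 1)); try lia.
  apply: bidegM; first exact: bidegXn.
  apply: bidegD; last by apply/bidegN/bidegX.
  by apply: (@bidegW _ 0 0) => //; exact: bideg1.
have nE : n = (N ^ m.+1)%N by rewrite /n card_ffun !card_ord.
have nB : (N ^ m.+1 <= (2 * m.+1) ^ m.+1)%N by rewrite leq_exp2r.
apply: bideg_sum => sg _.
have dprod : bideg (n * m.+1) (n * 1) (\prod_i (y%:M - map_mx polyC T) i (sg i)).
  by apply: bideg_prod.
have {}dprod : bideg (m.+1 * (2 * m.+1) ^ m.+1) (m.+1 * (2 * m.+1) ^ m.+1)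
    (\prod_i (y%:M - map_mx polyC T) i (sg i)).
  by apply: bidegW dprod; rewrite nE; move: nB; move: (N ^ _)%N ((2 * _) ^ _)%N; nia.
by case: (odd_perm sg); rewrite ?expr1 ?expr0 ?mulN1r ?mul1r //; apply: bidegN.
Qed.

End Equation.

(** * Orthogonal projectors *)

Section Projector.
Variables (K : realFieldType) (U : nat) (e : nat -> 'cV[K]_U).

(* The orthogonal projector onto the vectors orthogonal to [e 0], ..., [e k.-1].
   If [e k] belongs to the span of its predecessors then [W *m e k = 0] and the
   division by 0 leaves [W] unchanged. *)
Fixpoint projector (k : nat) : 'M[K]_U :=
  if k is k'.+1 then
    let W := projector k' in let t := W *m e k' in
    W - (((e k')^T *m t) 0 0)^-1 *: (t *m t^T)
  else 1%:M.

Lemma sqnorm_eq0 (t : 'cV[K]_U) : (t^T *m t) 0 0 = 0 -> t = 0.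
Proof.
rewrite mxE => /eqP; rewrite psumr_eq0 => [/allP h|i _]; last first.
  by rewrite mxE -expr2 sqr_ge0.
apply/matrixP => i j; rewrite ord1 [RHS]mxE.
have /implyP := h i (mem_index_enum _).
by rewrite mxE mulf_eq0 orbb => /(_ isT)/eqP.
Qed.

(** Symmetry and idempotence give [t^T t = e^T t = D], so each step subtracts the orthogonal
    projector onto the line of [t]. *)
Lemma projectorP k : [/\ (projector k)^T = projector k,
  projector k *m projector k = projector k,
  forall l, (l < k)%N -> projector k *m e l = 0 &
  forall v : 'cV_U, (forall l, (l < k)%N -> (e l)^T *m v = 0) -> projector k *m v = v].
Proof.
elim: k => [|k [IH1 IH2 IH3 IH4]] /=.
  by split=> //; rewrite ?trmx1 ?mulmx1 // => v _; rewrite mul1mx.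
set W := projector k in IH1 IH2 IH3 IH4 *.
set t := W *m e k; set D := ((e k)^T *m t) 0 0.
have Wt : W *m t = t by rewrite mulmxA IH2.
have tW : t^T *m W = t^T by rewrite /t trmx_mul -mulmxA IH1 IH2.
have tt : t^T *m t = D%:M.
  by rewrite [LHS]mx11_scalar {1}/t trmx_mul -mulmxA IH1 Wt.
have et : (e k)^T *m t = D%:M by rewrite [LHS]mx11_scalar.
have te : t^T *m e k = D%:M by rewrite /t trmx_mul -mulmxA IH1 -et.
have D0 : D = 0 -> t = 0.
  by move=> D0; apply: sqnorm_eq0; rewrite tt D0 mxE.
(* If [D = 0] then [t = 0], so the default value of the inverse is harmless and one computation
   covers both cases. *)
have DD : D^-1 *: (D *: t) = t.
  by have [/D0 ->|D0'] := eqVneq D 0; rewrite ?scaler0 // scalerA mulVf // scale1r.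
split.
- by rewrite linearB linearZ /= trmx_mul trmxK IH1.
- rewrite mulmxBl !mulmxBr -!scalemxAl -!scalemxAr IH2 mulmxA Wt.
  rewrite -[t *m t^T *m W]mulmxA tW mulmxA -[t *m t^T *m t]mulmxA tt.
  by rewrite mul_mx_scalar [D^-1 *: (D *: t *m _)]scalemxAl DD subrr subr0.
- move=> l; rewrite ltnS leq_eqVlt => /orP[/eqP ->|lk].
    rewrite mulmxBl -scalemxAl -mulmxA te mul_mx_scalar DD.
    by rewrite /t subrr.
  rewrite mulmxBl -scalemxAl -mulmxA IH3 // sub0r.
  by rewrite /t trmx_mul -!mulmxA IH1 IH3 // !mulmx0 scaler0 oppr0.
move=> v vk; rewrite mulmxBl -scalemxAl -mulmxA IH4; last first.
  by move=> l lk; apply: vk; exact: ltnW.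
have -> : t^T *m v = 0.
  rewrite /t trmx_mul -mulmxA IH1 IH4 ?vk // => l lk; apply: vk; exact: ltnW.
by rewrite mulmx0 scaler0 subr0.
Qed.

(** As [W = W^T W], a diagonal entry is the squared norm of a column. Searching the diagonal thus
    suffices to find a nonzero row. *)
Lemma projector_diag k : projector k != 0 -> exists p, projector k p p != 0.
Proof.
have [Wsym Widem _ _] := projectorP k.
move=> W0; apply/existsP; apply: contraNT W0; rewrite negb_exists => /forallP diag0.
apply/eqP/matrixP => i j.
have: col j (projector k) = 0.
  apply: sqnorm_eq0; rewrite tr_col Wsym.
  have := diag0 j; rewrite negbK -{1}Widem => /eqP h; rewrite -[RHS]h !mxE.
  by apply: eq_bigr => l _; rewrite !mxE.
by move/matrixP/(_ i 0); rewrite !mxE.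
Qed.

End Projector.

(** * First passage probabilities *)

Section Probability.
Local Open Scope classical_set_scope.

Lemma probability_setI1 (R : realType) (d : measure_display)
    (T : measurableType d) (P : probability T R) (A B : set T) :
  measurable A -> measurable B -> P B = 1%E -> P (A `&` B) = P A.
Proof.
move=> mA mB PB; have PC0 : P (A `&` ~` B) = 0%E.
  apply: (@subset_measure0 _ _ _ P _ (~` B)) => //.
  - by apply: measurableI => //; exact: measurableC.
  - exact: measurableC.
  by have <- : P (~` B) = 0%E by rewrite probability_setC // PB subee.
rewrite -[in RHS](setIT A) -(setUv B) setIUr measureU //; last 3 first.
- exact: measurableI.
- by apply: measurableI => //; exact: measurableC.
- by rewrite setIACA setICr setI0.
by rewrite [X in (_ + X)%E]PC0 adde0.
Qed.

Lemma bigsetU_ordP (T : Type) n (F : 'I_n -> set T) w :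
  (\big[setU/set0]_(j < n) F j) w <-> exists j, F j w.
Proof.
rewrite -bigcup_seq; split=> [[j _ h]|[j h]]; exists j => //=.
exact: mem_index_enum.
Qed.

Section FirstPassage.
Context (R : realType) (D : die R) (d : measure_display) (T : measurableType d)
  (P : probability T R) (Y : nat -> {RV P >-> R}).
Hypothesis rolls : independent_rolls D Y.

Let roll i j : set T := [set w | Y i w = (face D j)%:~R].

Lemma measurable_roll i j : measurable (roll i j).
Proof.
have -> : roll i j = Y i @^-1` [set (face D j)%:~R] by [].
by rewrite -[X in measurable X]setTI; exact: measurable_funP.
Qed.

Lemma P_roll i j : P (roll i j) = (weight D j)%:E.
Proof.
have [_ /(_ i j) <-] := rolls; rewrite fineK //.
exact: (fin_num_measure P _ (measurable_roll i j)).
Qed.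

Lemma roll_disjoint i : trivIset setT (roll i).
Proof.
move=> j j' _ _ [w [/= h1]]; rewrite /roll /= h1 => /eqP; rewrite eqr_int => /eqP.
exact: face_inj.
Qed.

Let prefix (p : nat -> 'I_(faces D)) m : set T :=
  [set w | forall i, (i < m)%N -> roll i (p i) w].

Lemma prefixE p m :
  prefix p m = \bigcap_(i in [set` iota 0 m]) roll i (p i).
Proof.
apply/seteqP; split=> w /= h i; last by move=> im; apply: h; rewrite /= mem_iota.
by rewrite /= mem_iota => /= im; apply: h.
Qed.

Lemma measurable_prefix p m : measurable (prefix p m).
Proof.
rewrite prefixE; apply: bigcap_measurableType => i _.
exact: measurable_roll.
Qed.

Lemma P_prefix p m : P (prefix p m) = (\prod_(i < m) weight D (p i))%:E.
Proof.
have [ind _] := rolls.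
have := ind (iota 0 m) (fun i => [set (face D (p i))%:~R]) (iota_uniq 0 m)
  (fun=> measurable_set1 _).
rewrite prefixE => ->.
rewrite -(big_mkord xpredT (fun i => weight D (p i))) /index_iota subn0 /=.
by elim/big_rec2: _ => // i x y _ ->; rewrite EFinM; congr (_ * _)%E; exact: P_roll.
Qed.

(* The event that, from round [m] on and with initial capital [x], all the
   rolls are faces and the capital becomes positive after exactly [n] rounds. *)
Fixpoint passage m n (x : int) : set T :=
  if n is n'.+1 then
    if x <= 0 then \big[setU/set0]_(j < faces D)
      (roll m j `&` passage m.+1 n' (x + face D j))
    else set0
  else if 0 < x then setT else set0.

Lemma measurable_passage m n x : measurable (passage m n x).
Proof.
elim: n m x => [|n IHn] m x /=; first by case: ifP.
case: ifP => // _; apply: bigsetU_measurable => j _.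
by apply: measurableI => //; exact: measurable_roll.
Qed.

(** The prefix absorbs each new roll, so independence enters only through [P_prefix]. *)
Lemma P_prefix_passage n p m x : P (prefix p m `&` passage m n x) =
  (\prod_(i < m) weight D (p i) * walk (face D) (weight D) (fun=> 1) n x)%:E.
Proof.
elim: n p m x => [|n IHn] p m x /=.
  by case: ifP => _; rewrite ?setIT ?P_prefix ?mulr1 // setI0 measure0 mulr0.
case: ifP => _; last by rewrite setI0 measure0 mulr0.
have mI j : measurable (prefix p m `&` (roll m j `&` passage m.+1 n (x + face D j))).
  apply: measurableI; first exact: measurable_prefix.
  by apply: measurableI; [exact: measurable_roll | exact: measurable_passage].
have -> : prefix p m `&` \big[setU/set0]_(j < faces D)
    (roll m j `&` passage m.+1 n (x + face D j)) = \big[setU/set0]_(j < faces D)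
    (prefix p m `&` (roll m j `&` passage m.+1 n (x + face D j))).
  by elim/big_rec2: _ => [|j A B _ <-]; rewrite ?setI0 // setIUr.
rewrite measure_bigsetU_ord //; last first.
  move=> j j' _ _ [w [[_ [h _]] [_ [h' _]]]].
  by apply: (@roll_disjoint m) => //; exists w.
rewrite mulr_sumr -sumEFin; apply: eq_bigr => j _.
pose p' i := if i == m then j else p i.
have -> : prefix p m `&` (roll m j `&` passage m.+1 n (x + face D j)) =
    prefix p' m.+1 `&` passage m.+1 n (x + face D j).
  rewrite setIA; congr (_ `&` _); apply/seteqP; split=> [w [h hj] i|w h].
    rewrite ltnS leq_eqVlt /p'; case: eqP => [-> //|_ /= im]; exact: h.
  split=> [i im|]; last by have := h m (ltnSn m); rewrite /p' eqxx.
  by have := h i (ltnW im); rewrite /p' ltn_eqF.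
apply: (etrans (IHn _ _ _)); rewrite big_ord_recr /= {2}/p' eqxx -mulrA; congr (_ * _)%:E.
by apply: eq_bigr => i _; rewrite /p' ltn_eqF.
Qed.

Let pos m n (x : int) (w : T) : R := x%:~R + \sum_(i < n) Y (m + i)%N w.

Lemma passageE n m x (w : T) : passage m n x w <->
  [/\ forall l, (l < n)%N -> pos m l x w <= 0, 0 < pos m n x w &
      forall i, (i < n)%N -> exists j, roll (m + i) j w].
Proof.
elim: n m x => [|n IHn] m x /=.
  rewrite /pos big_ord0 addr0 ltr0z; case: ifP => x0.
    by split.
  by split=> [//|[]].
have pos0 : pos m 0 x w <= 0 = (x <= 0).
  by rewrite /pos big_ord0 addr0 lerz0.
have posS j l : roll m j w -> pos m l.+1 x w = pos m.+1 l (x + face D j) w.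
  rewrite /pos big_ord_recl addn0 => ->; rewrite intrD addrA; congr (_ + _).
  by apply: eq_bigr => i _; rewrite lift0 addnS addSn.
case: ifP => x0; last first.
  by split=> [//|[/(_ 0 isT)]]; rewrite pos0 x0.
split.
  case/bigsetU_ordP => j [rj /IHn [hl hp hf]]; split.
  - by case=> [_|l ln]; rewrite ?pos0 // (posS j) //; apply: hl.
  - by rewrite (posS j).
  - case=> [_|i iN]; first by exists j; rewrite addn0.
    by rewrite addnS -addSn; apply: hf.
case=> hl hp hf; have [j] := hf 0%N isT; rewrite addn0 => rj.
apply/bigsetU_ordP; exists j; split => //; apply/IHn; split.
- by move=> l ln; rewrite -posS //; apply: hl.
- by rewrite -posS.
- by move=> i iN; have := hf i.+1 iN; rewrite addnS -addSn.
Qed.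

Lemma rounds_Some k : [set w | rounds (fun n => Y n : T -> R) w = Some k] =
  [set w | (forall l, (l < k)%N -> pos 0 l 0 w <= 0) /\ 0 < pos 0 k 0 w].
Proof.
have posE n w : pos 0 n 0 w = capital (fun n => Y n : T -> R) n w.
  by rewrite /pos add0r.
apply/seteqP; split=> w; rewrite /= /rounds.
  case: pselect => // h [] <-; case: ex_minnP => n nw nmin.
  rewrite posE; split=> // l ln; rewrite posE leNgt.
  by apply: contraTN ln => /nmin; rewrite -leqNgt.
case=> hl hk; case: pselect => [h|]; last by case; exists k; rewrite -posE.
congr Some; case: ex_minnP => n nw nmin.
apply/eqP; rewrite eqn_leq nmin -?posE // andTb leqNgt; apply/negP => nk.
by have := hl n nk; rewrite posE leNgt nw.
Qed.

Lemma measurable_pos_le0 m n x : measurable [set w | pos m n x w <= 0].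
Proof.
rewrite -[X in measurable X]setTI; apply: measurable_fun_le => //.
apply: measurable_realfun.measurable_funD => //; apply: measurable_sum => i.
exact: measurable_funP.
Qed.

(** The event [X = k] differs from [passage] only where one of the first [k] rolls is not a face,
    which has probability 0 because the weights sum to 1. *)
Lemma rounds_pmfE k :
  rounds_pmf Y k = walk (face D) (weight D) (fun=> 1) k 0.
Proof.
rewrite /rounds_pmf rounds_Some; set E := [set w | _].
have mE : measurable E.
  have -> : E = \bigcap_(l in [set l | (l < k)%N]) [set w | pos 0 l 0 w <= 0]
      `&` ~` [set w | pos 0 k 0 w <= 0].
    apply/seteqP; split=> w /= [h1 h2]; split=> //.
      by apply/negP; rewrite -ltNge.
    by rewrite ltNge; apply/negP.
  apply: measurableI; last exact/measurableC/measurable_pos_le0.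
  by apply: bigcap_measurableType => l _; exact: measurable_pos_le0.
pose G n : set T := [set w | forall i, (i < n)%N -> exists j, roll i j w].
(* A face exists because an empty sum is not 1; it only fills the empty prefix. *)
have [j0 _] : exists j : 'I_(faces D), true.
  case: D => [[|r] f q _ _ _ /= q1 _]; last by exists ord0.
  by move/eqP: q1; rewrite big_ord0 eq_sym oner_eq0.
have GS n : G n.+1 = G n `&` \big[setU/set0]_(j < faces D) roll n j.
  apply/seteqP; split=> [w h|w [h /bigsetU_ordP[j hj]] i].
    split=> [i iN|]; first by apply: h; exact: ltnW.
    by apply/bigsetU_ordP; exact: h.
  by rewrite ltnS leq_eqVlt => /orP[/eqP ->|/h //]; exists j.
have mU n : measurable (\big[setU/set0]_(j < faces D) roll n j).
  by apply: bigsetU_measurable => j _; exact: measurable_roll.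
have mG n : measurable (G n).
  elim: n => [|n IHn]; last by rewrite GS; apply: measurableI.
  by rewrite (_ : G 0%N = setT) //; apply/seteqP; split.
have PEG n : P (E `&` G n) = P E.
  elim: n => [|n IHn]; first by rewrite (_ : G 0%N = setT) ?setIT //; apply/seteqP; split.
  rewrite GS setIA probability_setI1 //; first exact: measurableI.
  rewrite measure_bigsetU_ord; last 2 first.
  - by move=> j; exact: measurable_roll.
  - exact: roll_disjoint.
  rewrite (eq_bigr (fun j => (weight D j)%:E)); first by rewrite sumEFin weight_sum1.
  by move=> j _; exact: P_roll.
rewrite -(PEG k) (_ : E `&` G k = prefix (fun=> j0) 0 `&` passage 0 k 0).
  by rewrite P_prefix_passage big_ord0 mul1r.
have -> : prefix (fun=> j0) 0 = setT by apply/seteqP; split.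
rewrite setTI; apply/seteqP; split=> w; first by case=> [[h1 h2] h3]; apply/passageE.
by move/passageE => [].
Qed.

End FirstPassage.

End Probability.

(** * A weakest precondition calculus *)

(* Entry [(i, j)] of array [t] is stored in the scalar cell [cell t i j]. As
   [pairing] is injective on all of [nat * nat], arrays need no bounds, and as
   these cells are negative they are disjoint from the input and the output. *)
Definition pairing (i j : nat) : nat := ((i + j) * (i + j) + j)%N.

(** The values with [i + j = s] lie between [s^2] and [s^2 + s], below [(s + 1)^2], and so determine
    [s]. *)
Lemma pairing_inj i j i' j' : pairing i j = pairing i' j' -> i = i' /\ j = j'.
Proof.
rewrite /pairing => h; suff : (i + j = i' + j')%N by nia.
by case: (ltngtP (i + j)%N (i' + j')%N) => // ij; nia.
Qed.

Definition cell (t i j : nat) : int := Negz (pairing t (pairing i j)).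

Lemma cell_eq t i j t' i' j' :
  (cell t' i' j' == cell t i j) = [&& t' == t, i' == i & j' == j].
Proof.
apply/eqP/and3P => [[] /pairing_inj[-> /pairing_inj[-> ->]]|]; first by rewrite !eqxx.
by case=> /eqP -> /eqP -> /eqP ->.
Qed.

Definition ipair (e1 e2 : iexp) : iexp :=
  IAdd (IMul (IAdd e1 e2) (IAdd e1 e2)) e2.
Definition icell (t : nat) (e1 e2 : iexp) : iexp :=
  ISub (IConst (-1)) (ipair (IConst t) (ipair e1 e2)).
(** Variables occupy negative integer cells, away from the input and the output. *)
Definition var (c : nat) : iexp := IGet (IConst (Negz c)).
Definition iset (c : nat) (e : iexp) : cmd := ISet (IConst (Negz c)) e.
Definition fget t e1 e2 : fexp := FGet (icell t e1 e2).
Definition fset t e1 e2 (f : fexp) : cmd := FSet (icell t e1 e2) f.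
(** [BIntLe] is not strict, hence the [+ 1]. The bound is evaluated again at every turn. *)
Definition For (v : nat) (bnd : iexp) (body : cmd) : cmd :=
  Seq (iset v (IConst 0))
    (While (BIntLe (IAdd (var v) (IConst 1)) bnd)
       (Seq body (iset v (IAdd (var v) (IConst 1))))).

Section Wp.
Variable R : realType.
Implicit Types (st : state R) (Q : state R -> Prop) (c : cmd).

Definition arr st t i j : R := fmem st (cell t i j).
Definition seti st v (z : int) : state R :=
  State (update (imem st) (Negz v) z) (fmem st).
Definition setf st t i j (x : R) : state R :=
  State (imem st) (update (fmem st) (cell t i j) x).

Lemma arr_setf st t i j x t' i' j' : arr (setf st t i j x) t' i' j' =
  if [&& t' == t, i' == i & j' == j] then x else arr st t' i' j'.
Proof. by rewrite /arr /= /update cell_eq. Qed.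

Lemma arr_seti st v z t i j : arr (seti st v z) t i j = arr st t i j.
Proof. by []. Qed.

Lemma imem_seti st v z w :
  imem (seti st v z) w = if w == Negz v then z else imem st w.
Proof. by []. Qed.

Lemma ieval_cell st t e1 e2 (i j : nat) :
  ieval st e1 = i%:Z -> ieval st e2 = j%:Z -> ieval st (icell t e1 e2) = cell t i j.
Proof. by move=> /= -> ->; rewrite /cell /pairing NegzE; lia. Qed.

(* Over-approximates the set of integer cells that a program writes. *)
Fixpoint iwrites c (z : int) : bool :=
  match c with
  | ISet (IConst a) _ => z == a
  | ISet _ _ => true
  | Seq c1 c2 => iwrites c1 z || iwrites c2 z
  | If _ c1 c2 => iwrites c1 z || iwrites c2 z
  | While _ c1 => iwrites c1 z
  | _ => false
  end.

Definition iframe c st st' := forall z, ~~ iwrites c z -> imem st' z = imem st z.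

Lemma exec_iframe c st st' : exec c st st' -> iframe c st st'.
Proof.
elim=> {c st st'} //=.
- by move=> st [] //= a e z /=; rewrite /update => /negbTE ->.
- by move=> c1 c2 st1 st2 st3 _ h1 _ h2 z /= /norP[z1 z2]; rewrite h2 ?h1.
- by move=> b c1 c2 st1 st2 _ _ h1 z /= /norP[z1 z2]; rewrite h1.
- by move=> b c1 c2 st1 st2 _ _ h1 z /= /norP[z1 z2]; rewrite h1.
- by move=> b c st1 st2 st3 _ _ h1 _ h2 z /= zc; rewrite h2 ?h1.
Qed.

(** Total correctness: a terminating execution is part of the claim. *)
Definition wp c Q st := exists2 st', exec c st st' & Q st'.

(** The frame of [c1] is handed on, so specifications need not list the integer cells they
    preserve. *)
Lemma wp_seq c1 c2 Q st :
  wp c1 (fun st' => iframe c1 st st' -> wp c2 Q st') st -> wp (Seq c1 c2) Q st.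
Proof.
case=> st1 e1 h; have [st2 e2 q] := h (exec_iframe e1); exists st2 => //.
exact: exec_seq e1 e2.
Qed.

Lemma wp_skip Q st : Q st -> wp Skip Q st.
Proof. by exists st => //; exact: exec_skip. Qed.

Lemma wp_iset v e z Q st : ieval st e = z -> Q (seti st v z) -> wp (iset v e) Q st.
Proof. by move=> <- q; exists (seti st v (ieval st e)) => //; exact: exec_iset. Qed.

Lemma wp_fset t e1 e2 f i j x Q st : ieval st e1 = i%:Z -> ieval st e2 = j%:Z ->
  feval st f = x -> Q (setf st t i j x) -> wp (fset t e1 e2 f) Q st.
Proof.
move=> h1 h2 <- q; exists (setf st t i j (feval st f)) => //.
by rewrite /setf -(ieval_cell t h1 h2); exact: exec_fset.
Qed.

Lemma wp_if b c1 c2 Q st :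
  (beval st b -> wp c1 Q st) -> (~~ beval st b -> wp c2 Q st) -> wp (If b c1 c2) Q st.
Proof.
case: (boolP (beval st b)) => hb h1 h2.
  by have [st' e q] := h1 isT; exists st' => //; exact: exec_if_true.
by have [st' e q] := h2 isT; exists st' => //; exact: exec_if_false.
Qed.

(** As the bound is evaluated at every turn, it must be worth [n] in all states allowed by the frame
    of the loop. The invariant speaks of the state after the counter has been set. *)
Lemma wp_for v bnd body (n : nat) (Inv : nat -> state R -> Prop) Q st :
  ~~ iwrites body (Negz v) ->
  (forall st', iframe (For v bnd body) st st' -> ieval st' bnd = n%:Z) ->
  Inv 0%N (seti st v 0) ->
  (forall i st', (i < n)%N -> iframe (For v bnd body) st st' ->
     imem st' (Negz v) = i%:Z -> Inv i st' ->
     wp body (fun st'' => iframe body st' st'' -> Inv i.+1 (seti st'' v i.+1%:Z)) st') ->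
  (forall st', iframe (For v bnd body) st st' -> Inv n st' -> Q st') ->
  wp (For v bnd body) Q st.
Proof.
move=> vbody bndE Inv0 InvS InvQ.
set loop := While (BIntLe (IAdd (var v) (IConst 1)) bnd)
  (Seq body (iset v (IAdd (var v) (IConst 1)))).
have fr0 st' : iframe loop (seti st v 0) st' -> iframe (For v bnd body) st st'.
  move=> fr z zw; rewrite fr; last by move: zw => /= /norP[].
  by rewrite imem_seti; move: zw => /= /norP[/negbTE ->].
suff [st' e inv] : exists2 st', exec loop (seti st v 0) st' & Inv n st'.
  exists st'; first by apply: exec_seq e; exact: exec_iset.
  by apply: InvQ => //; apply: fr0; exact: exec_iframe e.
(* Induction on the number [k] of turns left. *)
have main k : forall st1, (k <= n)%N -> iframe loop (seti st v 0) st1 ->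
    imem st1 (Negz v) = (n - k)%N%:Z -> Inv (n - k)%N st1 ->
    exists2 st', exec loop st1 st' & Inv n st'.
  elim: k => [|k IHk] st1 kn fr1 v1 inv1.
    exists st1; last by rewrite subn0 in inv1.
    apply: exec_while_false; rewrite /= v1 bndE; last exact: fr0.
    by rewrite subn0; lia.
  have [||||st2 e2 inv2] := InvS (n - k.+1)%N st1 => //; [by lia|exact: fr0|].
  have fr2 := exec_iframe e2.
  have v2 : imem st2 (Negz v) = (n - k.+1)%N%:Z by rewrite fr2.
  pose st3 := seti st2 v (n - k)%N%:Z.
  have eqk : (n - k.+1).+1 = (n - k)%N by lia.
  have fr3 : iframe loop (seti st v 0) st3.
    move=> z zl; have /norP[z1 z2] : ~~ (iwrites body z || (z == Negz v)) := zl.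
    by rewrite /st3 [LHS]imem_seti (negbTE z2) fr2 // fr1.
  have [|||st4 e4 inv4] := IHk st3 _ fr3 => //.
  - exact: ltnW.
  - by rewrite imem_seti eqxx.
  - by rewrite /st3 -eqk; exact: inv2.
  exists st4 => //; apply: (exec_while_true _ _ e4).
    by rewrite /= v1 bndE; [lia | exact: fr0].
  apply: exec_seq e2 _.
  have -> : st3 = seti st2 v (ieval st2 (IAdd (var v) (IConst 1))).
    by rewrite /= v2 /st3 -eqk; congr seti; lia.
  exact: exec_iset.
have [] := main n (seti st v 0) => //.
- by rewrite imem_seti eqxx subnn.
- by rewrite subnn.
by move=> st' e inv; exists st'.
Qed.

Lemma wp_for_sum v bnd t e1 e2 g (n i j : nat) (G : nat -> R) Q st :
  (forall st', (forall z, z != Negz v -> imem st' z = imem st z) ->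
     [/\ ieval st' bnd = n%:Z, ieval st' e1 = i%:Z & ieval st' e2 = j%:Z]) ->
  (forall l st', (l < n)%N -> imem st' (Negz v) = l%:Z ->
     (forall z, z != Negz v -> imem st' z = imem st z) ->
     (forall z, z != cell t i j -> fmem st' z = fmem st z) ->
     feval st' g = G l) ->
  (forall st', (forall z, z != Negz v -> imem st' z = imem st z) ->
     (forall z, z != cell t i j -> fmem st' z = fmem st z) ->
     arr st' t i j = arr st t i j + \sum_(l < n) G l -> Q st') ->
  wp (For v bnd (fset t e1 e2 (FAdd (fget t e1 e2) g))) Q st.
Proof.
move=> ev evg post.
have frE st' : iframe (For v bnd (fset t e1 e2 (FAdd (fget t e1 e2) g))) st st' ->
    forall z, z != Negz v -> imem st' z = imem st z.
  by move=> fr z zv; apply: fr; rewrite /= orbb.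
apply: (@wp_for _ _ _ n (fun l st' =>
  (forall z, z != cell t i j -> fmem st' z = fmem st z) /\
  arr st' t i j = arr st t i j + \sum_(l' < l) G l')) => //.
- by move=> st' /frE /ev [].
- by rewrite big_ord0 addr0.
- move=> l st' ln /frE fr vl [frm acc].
  have [_ h1 h2] := ev _ fr.
  have hf : feval st' (FAdd (fget t e1 e2) g) = arr st' t i j + G l.
    rewrite -[LHS]/(fmem st' (ieval st' (icell t e1 e2)) + feval st' g).
    by rewrite (ieval_cell t h1 h2) (evg l).
  apply: (wp_fset h1 h2 hf) => _; split.
    by move=> z zc; rewrite /= /update (negbTE zc) frm.
  by rewrite [LHS]arr_setf !eqxx acc big_ord_recr /= addrA.
- by move=> st' /frE fr [frm acc]; apply: post.
Qed.

End Wp.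

Arguments arr : simpl never.
Arguments setf : simpl never.
Arguments seti : simpl never.

(** * The table of first passage probabilities *)

Definition vM := 0%N.
Definition vB := 1%N.
Definition vn := 2%N.
Definition vL := 3%N.
Definition vU := 4%N.
Definition vE := 5%N.
Definition vp := 6%N.
Definition vi := 7%N.
Definition vj := 8%N.
Definition vk := 9%N.

(* Arrays: [tT k t] is the probability of a first passage after [k] rounds from
   capital [M - t]; [tW] is the projector, [tE] the current equation, [tV] its
   image under the projector, and [tS] holds auxiliary scalars. *)
Definition tT := 0%N.
Definition tW := 1%N.
Definition tE := 2%N.
Definition tV := 3%N.
Definition tS := 4%N.

Definition ione := IConst 1.
Definition izero := IConst 0.
Definition face_exp (e : iexp) := IGet (IAdd e ione).

(** Columns [t < M] stand for positive capital, where passage takes 0 rounds. *)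
Definition table_init : cmd := For vi (var vM) (fset tT izero (var vi) FOne).

Definition table_entry : cmd :=
  let row := IAdd (var vk) ione in let col := IAdd (var vM) (var vi) in
  For vj (IGet izero) (fset tT row col (FAdd (fget tT row col)
    (FMul (FGet (var vj)) (fget tT (var vk) (ISub col (face_exp (var vj))))))).

(** Only column [M] is wanted in the end. A roll moves the column by at most [M], so each row may be
    [M] columns shorter than the one before. *)
Definition table_row : cmd :=
  For vi (IMul (ISub (var vE) (var vk)) (var vM)) table_entry.

Definition table_prog : cmd := For vk (var vE) table_row.

(** * Correctness of the table *)

Section Phases.
Variables (R : realType) (D : die R) (M n L U E : nat).
Implicit Types st : state R.

Record par st : Prop := Par {
  par_M : imem st (Negz vM) = M%:Z;
  par_n : imem st (Negz vn) = n%:Z;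
  par_L : imem st (Negz vL) = L%:Z;
  par_U : imem st (Negz vU) = U%:Z;
  par_E : imem st (Negz vE) = E%:Z;
  par_in : forall x : nat, imem st x%:Z = imem (input D) x%:Z }.

Lemma par_frame c st st' : par st -> iframe c st st' ->
  all (fun v => ~~ iwrites c (Negz v)) [:: vM; vn; vL; vU; vE] ->
  (forall x : nat, ~~ iwrites c x%:Z) -> par st'.
Proof.
move=> [h1 h2 h3 h4 h5 h6] fr /and5P[i1 i2 i3 i4 /andP[i5 _]] i6.
by split; rewrite ?fr // => x; rewrite fr.
Qed.

Lemma input_face (j : 'I_(faces D)) : imem (input D) j.+1%:Z = face D j.
Proof. by rewrite /= valK. Qed.

Definition fpass k t : R :=
  walk (face D) (weight D) (fun=> 1) k (M%:Z - t%:Z).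

Lemma wp_table_init st Q : par st ->
  (forall st', iframe table_init st st' ->
     (forall x : nat, fmem st' x%:Z = fmem st x%:Z) ->
     (forall t i j, arr st' t i j = if [&& t == tT, i == 0%N & (j < M)%N] then 1
        else arr st t i j) -> Q st') -> wp table_init Q st.
Proof.
move=> pst post; apply: (@wp_for _ _ _ _ M (fun l st' =>
  (forall x : nat, fmem st' x%:Z = fmem st x%:Z) /\
  (forall t i j, arr st' t i j = if [&& t == tT, i == 0%N & (j < l)%N] then 1
        else arr st t i j))) => //.
- by move=> st' fr; rewrite /= fr // par_M.
- by split=> // t i j; rewrite andbF andbF.
- move=> l st' lM fr vl [h1 h2].
  apply: (@wp_fset _ _ _ _ _ 0%N l 1) => // _; split=> // t i j.
  rewrite [LHS]arr_setf h2 ltnS (leq_eqVlt j).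
  by case: (t == tT); case: (i == 0%N); case: (j == l).
- by move=> st' fr [h1 h2]; apply: post.
Qed.

Hypothesis sM : forall j, (`|face D j| <= M)%N.

Lemma wp_table_entry st k i Q : par st -> imem st (Negz vk) = k%:Z ->
  imem st (Negz vi) = i%:Z ->
  (forall j : 'I_(faces D), fmem st (j : nat)%:Z = weight D j) ->
  arr st tT k.+1 (M + i) = 0 ->
  (forall t, (t <= M + i + M)%N -> arr st tT k t = fpass k t) ->
  (forall st', iframe table_entry st st' ->
     (forall z, z != cell tT k.+1 (M + i) -> fmem st' z = fmem st z) ->
     arr st' tT k.+1 (M + i) = fpass k.+1 (M + i) -> Q st') ->
  wp table_entry Q st.
Proof.
move=> pst kst ist wst z0 rowk post.
pose G l := if insub l is Some j then
  weight D j * walk (face D) (weight D) (fun=> 1) k (- i%:Z + face D j) else 0.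
apply: (@wp_for_sum _ _ _ _ _ _ _ (faces D) k.+1 (M + i) G).
- move=> st' fr; split=> /=; rewrite !fr //.
  + exact: (par_in pst 0%N).
  + by rewrite kst; lia.
  + by rewrite (par_M pst) ist; lia.
- move=> l st' lr vl fr fm.
  rewrite /G (insubT (fun l => (l < faces D)%N) lr); set j := Sub l lr.
  have sj := sM j.
  have faceE : ieval st' (face_exp (var vj)) = face D j.
    rewrite /= vl (_ : l%:Z + 1 = l.+1%:Z); last by lia.
    by rewrite fr // (par_in pst) -(input_face j).
  rewrite -[LHS]/(fmem st' (imem st' (Negz vj)) * fmem st' (ieval st'
    (icell tT (var vk) (ISub (IAdd (var vM) (var vi)) (face_exp (var vj)))))).
  (* The column is nonnegative because no face exceeds [M], so taking its absolute value is
     harmless. *)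
  rewrite (@ieval_cell _ _ _ _ _ k `|(M + i)%N%:Z - face D j|%N); first last.
  + rewrite -[LHS]/(imem st' (Negz vM) + imem st' (Negz vi) -
      ieval st' (face_exp (var vj))).
    by rewrite faceE !fr // (par_M pst) ist; lia.
  + by rewrite /= fr.
  rewrite vl !fm //; last by rewrite cell_eq /= ltn_eqF.
  rewrite (wst j) -/(arr _ _ _ _) rowk; last by lia.
  by congr (_ * walk _ _ _ _ _); lia.
- move=> st' fr fm acc; apply: post => //.
    by move=> z zw; apply: fr; move: zw; rewrite /= orbb.
  rewrite acc z0 add0r /fpass /= ifT; last by lia.
  apply: eq_bigr => j _; rewrite /G valK; congr (_ * walk _ _ _ _ _); lia.
Qed.

Lemma wp_table_row st k Q : par st -> imem st (Negz vk) = k%:Z -> (k < E)%N ->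
  (forall j : 'I_(faces D), fmem st (j : nat)%:Z = weight D j) ->
  (forall t, arr st tT k.+1 t = 0) ->
  (forall t, (t < (E - k).+2 * M)%N -> arr st tT k t = fpass k t) ->
  (forall st', (forall x : nat, fmem st' x%:Z = fmem st x%:Z) ->
     (forall t i j, (t != tT) || (i != k.+1) -> arr st' t i j = arr st t i j) ->
     (forall t, (t < (E - k).+1 * M)%N -> arr st' tT k.+1 t = fpass k.+1 t) ->
     Q st') -> wp table_row Q st.
Proof.
move=> pst kst kE wst z0 rowk post.
apply: (@wp_for _ _ _ _ ((E - k) * M)%N (fun i st' =>
  [/\ forall x : nat, fmem st' x%:Z = fmem st x%:Z,
      forall t i j, (t != tT) || (i != k.+1) -> arr st' t i j = arr st t i j,
      forall t, (t < M + i)%N -> arr st' tT k.+1 t = fpass k.+1 t &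
      forall t, (M + i <= t)%N -> arr st' tT k.+1 t = 0])) => //.
- by move=> st' fr; rewrite /= !fr // (par_E pst) (par_M pst) kst; lia.
- split=> // [t tM|t _]; last exact: z0.
  (* Columns [t < M] have positive capital, from which no passage takes [k.+1] rounds; the initial 0
     is right. *)
  by rewrite [LHS]z0 /fpass /= ifF //; apply/negbTE; lia.
- move=> i st' iE fr ist [h1 h2 h3 h4].
  have pst' : par st' by apply: par_frame pst fr _ _.
  apply: (@wp_table_entry _ k i) => //.
  + by rewrite fr.
  + by move=> j; rewrite h1.
  + by apply: h4.
  + move=> t tMi; rewrite h2 ?orbT ?rowk //; last by apply/eqP; lia.
    rewrite !mulSn; have : (i + 1 <= (E - k) * M)%N by lia.
    by lia.
  + move=> st'' fr'' fm entry _; split=> //.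
    * by move=> x; rewrite -h1; apply: fm.
    * move=> t i' j tk; rewrite -h2 //; apply: fm; rewrite cell_eq.
      by move: tk; case: eqP; case: eqP.
    * move=> t; rewrite addnS ltnS leq_eqVlt => /orP[/eqP ->//|tMi].
      by rewrite -h3 //; apply: fm; rewrite cell_eq !eqxx /= ltn_eqF.
    * move=> t tMi; rewrite -(h4 t); last by lia.
      by apply: fm; rewrite cell_eq !eqxx /=; apply/eqP; lia.
- move=> st' fr [h1 h2 h3 h4]; apply: post => // t tE; exact: h3.
Qed.

Lemma wp_table_prog st Q : par st -> (0 < M)%N ->
  (forall j : 'I_(faces D), fmem st (j : nat)%:Z = weight D j) ->
  (forall t, arr st tT 0 t = (t < M)%N%:R) ->
  (forall k t, arr st tT k.+1 t = 0) ->
  (forall st', iframe table_prog st st' ->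
     (forall t i j, t != tT -> arr st' t i j = arr st t i j) ->
     (forall k, (k <= E)%N -> arr st' tT k M = fpass k M) -> Q st') ->
  wp table_prog Q st.
Proof.
move=> pst M0 wst row0 z0 post.
apply: (@wp_for _ _ _ _ E (fun k st' =>
  [/\ forall x : nat, fmem st' x%:Z = fmem st x%:Z,
      forall t i j, t != tT -> arr st' t i j = arr st t i j,
      forall k' t, (k' <= k)%N -> (t < (E - k').+2 * M)%N ->
        arr st' tT k' t = fpass k' t &
      forall k' t, (k < k')%N -> arr st' tT k' t = 0])) => //.
- by move=> st' fr; rewrite /= fr // (par_E pst).
- split=> // [k' t|[|k'] t _ //]; last exact: z0.
  rewrite leqn0 => /eqP -> _; rewrite [LHS]row0 /fpass /=.
  by rewrite subr_gt0 ltz_nat; case: ltnP.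
- move=> k st' kE fr kst [h1 h2 h3 h4].
  have pst' : par st' by apply: par_frame pst fr _ _.
  apply: (@wp_table_row _ k) => //.
  + by move=> j; rewrite h1.
  + by move=> t; apply: h4.
  + by move=> t tE; apply: h3.
  + move=> st'' fx fa row _; split.
    * by move=> x; rewrite -h1; apply: fx.
    * by move=> t i j tT; rewrite -h2 //; apply: fa; rewrite tT.
    * move=> k' t; rewrite leq_eqVlt => /orP[/eqP ->|k'k] tE.
        by apply: row; move: tE; rewrite subnSK.
      by rewrite -h3 //; apply: fa; rewrite (ltn_eqF k'k) orbT.
    * move=> k' t k'k; rewrite -(h4 k' t); last exact: ltnW.
      by apply: fa; rewrite (gtn_eqF k'k) orbT.
- move=> st' fr [h1 h2 h3 h4]; apply: post => // k kE; apply: h3 => //.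
  by rewrite !mulSn -[X in (X < _)%N]addn0 ltn_add2l addn_gt0 M0.
Qed.

End Phases.

(** * The linear solver *)

(* The scalar copy of the loop counter [vk]: integers cannot be converted. *)
Definition tK := 5%N.
Notation kappa := (fget tK izero izero).
Notation fval := (fget tS izero ione).
Notation fden := (fget tS ione izero).

Definition identity_prog : cmd :=
  For vi (var vU) (fset tW (var vi) (var vi) FOne).

(** [fval] runs through [k^e a(k - i)] by repeated multiplication by [kappa]. *)
Definition equation_powers : cmd :=
  For vj (var vn)
    (Seq (fset tE (IAdd (IMul (var vi) (var vn)) (var vj)) izero fval)
         (fset tS izero ione (FMul fval kappa))).

Definition equation_block : cmd :=
  Seq (If (BIntLe (var vi) (var vk))
         (fset tS izero ione (fget tT (ISub (var vk) (var vi)) (var vM)))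
         (fset tS izero ione FZero))
      equation_powers.

Definition equation_prog : cmd := For vi (IAdd (var vL) ione) equation_block.

Definition apply_row : cmd :=
  Seq (fset tV (var vi) izero FZero)
   (Seq (For vj (var vU) (fset tV (var vi) izero (FAdd (fget tV (var vi) izero)
          (FMul (fget tW (var vi) (var vj)) (fget tE (var vj) izero)))))
     (fset tS ione izero
       (FAdd fden (FMul (fget tV (var vi) izero) (fget tE (var vi) izero))))).

Definition apply_prog : cmd :=
  Seq (fset tS ione izero FZero) (For vi (var vU) apply_row).

Definition update_row : cmd :=
  For vj (var vU) (fset tW (var vi) (var vj) (FSub (fget tW (var vi) (var vj))
    (FDiv (FMul (fget tV (var vi) izero) (fget tV (var vj) izero)) fden))).

Definition update_prog : cmd := For vi (var vU) update_row.

(** One step of [projector]: [tE] receives [e k], [tV] its image [t], [fden] their scalar product,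
    and [tW] the rank-one update. [kappa] then follows the loop counter. *)
Definition solve_step : cmd :=
  Seq equation_prog (Seq apply_prog (Seq update_prog
    (fset tK izero izero (FAdd kappa FOne)))).

Definition solve_prog : cmd := For vk (var vE) solve_step.

Definition select_prog : cmd :=
  For vi (var vU) (If (BNot (BScalEq (fget tW (var vi) (var vi)) FZero))
    (iset vp (var vi)) Skip).

Definition output_prog : cmd :=
  Seq (For vi (var vU) (FSet (var vi) (fget tW (var vp) (var vi))))
    (Seq (ISet izero (var vL)) (ISet ione (var vn))).

Lemma feval_fget (R : realType) (st : state R) t e1 e2 (i j : nat) :
  ieval st e1 = i%:Z -> ieval st e2 = j%:Z -> feval st (fget t e1 e2) = arr st t i j.
Proof. by move=> h1 h2; rewrite /arr -(ieval_cell t h1 h2). Qed.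

(** * Correctness of the linear solver *)

Section Solver.
Variables (R : realType) (D : die R) (M n L U E : nat).
Implicit Types st : state R.
Local Notation par := (@par R D M n L U E).

Lemma par_setf st t i j x : par st -> par (setf st t i j x).
Proof. by case=> *; split. Qed.

Lemma wp_identity_prog st Q : par st -> (forall i j, arr st tW i j = 0) ->
  (forall st', iframe identity_prog st st' ->
     (forall t i j, t != tW -> arr st' t i j = arr st t i j) ->
     (forall i j, (i < U)%N -> arr st' tW i j = (i == j)%:R) -> Q st') ->
  wp identity_prog Q st.
Proof.
move=> pst z0 post; apply: (@wp_for _ _ _ _ U (fun l st' =>
  (forall t i j, t != tW -> arr st' t i j = arr st t i j) /\
  (forall i j, arr st' tW i j = ((i == j) && (i < l)%N)%:R))) => //.
- by move=> st' fr; rewrite /= fr // (par_U pst).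
- by split=> // i j; rewrite andbF; exact: z0.
- move=> l st' lU fr vl [h1 h2].
  apply: (@wp_fset _ _ _ _ _ l l 1) => // _; split=> [t i j tW|i j].
    by rewrite arr_seti [LHS]arr_setf (negbTE tW) /= h1.
  rewrite arr_seti [LHS]arr_setf h2 eqxx /= ltnS (leq_eqVlt i).
  case: (eqVneq i l) => [->|il] //=; by rewrite eq_sym; case: eqP; rewrite ?ltnn.
- by move=> st' fr [h1 h2]; apply: post => // i j iU; rewrite h2 iU andbT.
Qed.

Variable a : nat -> R.
(** The coefficient, in equation [k], of the unknown attached to ['X^e] in the [i]-th polynomial.
    Terms of negative index count as 0, so that equations with [k < L] make sense too. *)
Definition eqn k (i e : nat) : R :=
  k%:R ^+ e * (if (i <= k)%N then a (k - i) else 0).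
Definition eqn_flat k c := eqn k (c %/ n) (c %% n).

Lemma eqn_flatE k i e : (e < n)%N -> eqn_flat k (i * n + e) = eqn k i e.
Proof.
move=> en; have n0 : (0 < n)%N by exact: leq_ltn_trans en.
by rewrite /eqn_flat divnMDl // modnMDl divn_small // modn_small // addn0.
Qed.

Lemma wp_equation_powers st k i Q : par st ->
  imem st (Negz vi) = i%:Z -> arr st tK 0 0 = k%:R -> arr st tS 0 1 = eqn k i 0 ->
  (forall c, (c < i * n)%N -> arr st tE c 0 = eqn_flat k c) ->
  (forall st', (forall t i j, (t != tE) && (t != tS) -> arr st' t i j = arr st t i j) ->
     (forall c, (c < i.+1 * n)%N -> arr st' tE c 0 = eqn_flat k c) -> Q st') ->
  wp equation_powers Q st.
Proof.
move=> pst ist kap val prev post; apply: (@wp_for _ _ _ _ n (fun e st' =>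
  [/\ forall t i j, (t != tE) && (t != tS) -> arr st' t i j = arr st t i j,
      arr st' tS 0 1 = eqn k i e &
      forall c, (c < i * n + e)%N -> arr st' tE c 0 = eqn_flat k c])) => //.
- by move=> st' fr; rewrite /= fr // (par_n pst).
- by split=> // c; rewrite addn0; exact: prev.
- move=> e st' en fr vl [h1 h2 h3].
  apply: wp_seq; apply: (@wp_fset _ _ _ _ _ (i * n + e) 0 (eqn k i e)) => //.
    by rewrite /= vl !fr // (par_n pst) ist; lia.
  move=> _; apply: (@wp_fset _ _ _ _ _ 0 1 (eqn k i e.+1)) => //.
    rewrite -[LHS]/(feval _ fval * feval _ kappa).
    rewrite (@feval_fget _ _ tS _ _ 0 1) // (@feval_fget _ _ tK _ _ 0 0) //.
    by rewrite !arr_setf /= h2 h1 // kap /eqn exprSr mulrAC.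
  move=> _; split=> [t i' j tt'| |c].
  + rewrite arr_seti [LHS]arr_setf arr_setf -h1 //.
    by move/andP: tt' => [/negbTE -> /negbTE ->].
  + by rewrite arr_seti [LHS]arr_setf.
  + rewrite arr_seti [LHS]arr_setf /= arr_setf /= andbT addnS ltnS leq_eqVlt.
    by case: eqP => [-> _|_ /= cl]; [rewrite eqn_flatE | exact: h3].
- by move=> st' fr [h1 h2 h3]; apply: post => // c; rewrite mulSnr; exact: h3.
Qed.

Hypothesis UE : U = (L.+1 * n)%N.

Lemma wp_equation_prog st k Q : par st -> imem st (Negz vk) = k%:Z ->
  (k <= E)%N -> arr st tK 0 0 = k%:R ->
  (forall k', (k' <= E)%N -> arr st tT k' M = a k') ->
  (forall st', iframe equation_prog st st' ->
     (forall t i j, (t != tE) && (t != tS) -> arr st' t i j = arr st t i j) ->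
     (forall c, (c < U)%N -> arr st' tE c 0 = eqn_flat k c) -> Q st') ->
  wp equation_prog Q st.
Proof.
move=> pst kst kE kap tab post; apply: (@wp_for _ _ _ _ L.+1 (fun i st' =>
  (forall t i j, (t != tE) && (t != tS) -> arr st' t i j = arr st t i j) /\
  (forall c, (c < i * n)%N -> arr st' tE c 0 = eqn_flat k c))) => //.
- by move=> st' fr; rewrite /= fr // (par_L pst); lia.
- move=> i st' iL fr vl [h1 h2].
  have pst' : par st' by apply: par_frame pst fr _ _.
  have kst' : imem st' (Negz vk) = k%:Z by rewrite fr.
  apply: wp_seq.
  have next st'' x : st'' = setf st' tS 0 1 (eqn k i 0) ->
      iframe x st' st'' -> wp equation_powers
       (fun st3 : state R => iframe equation_block st' st3 ->
         (forall t i j, (t != tE) && (t != tS) ->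
            arr (seti st3 vi i.+1%:Z) t i j = arr st t i j) /\
         (forall c, (c < i.+1 * n)%N ->
            arr (seti st3 vi i.+1%:Z) tE c 0 = eqn_flat k c)) st''.
    move=> -> _; apply: (@wp_equation_powers _ k i) => //.
    + exact: par_setf.
    + by rewrite arr_setf /= h1.
    + by move=> c ci; rewrite arr_setf /=; exact: h2.
    + move=> st3 f3 e3 _; split=> // t i' j tt'.
      rewrite [LHS]f3 // arr_setf -h1 //.
      by move/andP: tt' => [_ /negbTE ->].
  apply: wp_if => hb.
    have ik : (i <= k)%N by move: hb; rewrite /= vl kst'.
    apply: (@wp_fset _ _ _ _ _ 0 1 (eqn k i 0)) => //; last by apply: next.
    rewrite (@feval_fget _ _ _ _ _ (k - i) M) //.
    - by rewrite h1 // tab ?/eqn ?ik ?mul1r //; lia.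
    - by rewrite /= vl kst'; lia.
    - exact: par_M pst'.
  have ik : (i <= k)%N = false by apply/negbTE; move: hb; rewrite /= vl kst'.
  apply: (@wp_fset _ _ _ _ _ 0 1 (eqn k i 0)) => //; last by apply: next.
  by rewrite /eqn ik mulr0.
- by move=> st' fr [h1 h2]; apply: post => // c cU; apply: h2; rewrite -UE.
Qed.

Lemma wp_apply_row st (i : nat) Q : par st -> imem st (Negz vi) = i%:Z ->
  (forall st', (forall t i j, (t != tV) && (t != tS) -> arr st' t i j = arr st t i j) ->
     (forall i', i' != i -> arr st' tV i' 0 = arr st tV i' 0) ->
     arr st' tV i 0 = \sum_(c < U) arr st tW i c * arr st tE c 0 ->
     arr st' tS 1 0 = arr st tS 1 0 + arr st' tV i 0 * arr st tE i 0 -> Q st') ->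
  wp apply_row Q st.
Proof.
move=> pst ist post.
apply: wp_seq; apply: (@wp_fset _ _ _ _ _ i 0 0) => //= _.
apply: wp_seq; apply: (@wp_for_sum _ _ _ _ _ _ _ U i 0
  (fun c => arr st tW i c * arr st tE c 0)).
- by move=> st' fr; split=> //=; rewrite fr // (par_U pst).
- move=> l st' lU vl fr fm.
  rewrite -[LHS]/(feval _ (fget _ _ _) * feval _ (fget _ _ _)).
  rewrite (@feval_fget _ _ tW _ _ i l) //; last by rewrite /= fr.
  rewrite (@feval_fget _ _ tE _ _ l 0) //.
  by rewrite /arr !fm ?cell_eq // -!/(arr _ _ _ _) !arr_setf.
- move=> st' fr fm acc _.
  have ist' : imem st' (Negz vi) = i%:Z by rewrite fr.
  have same t i' j : (t != tV) || (i' != i) -> arr st' t i' j = arr st t i' j.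
    move=> h; rewrite /arr fm; last first.
      by rewrite cell_eq; move: h; case: eqP; case: eqP.
    rewrite -/(arr _ _ _ _) arr_setf.
    by move: h; case: eqP; case: eqP.
  apply: (@wp_fset _ _ _ _ _ 1 0 (arr st tS 1 0 + arr st' tV i 0 * arr st tE i 0)) => //.
    rewrite -[LHS]/(feval _ fden + feval _ (fget _ _ _) * feval _ (fget _ _ _)).
    rewrite (@feval_fget _ _ tS _ _ 1 0) // (@feval_fget _ _ tV _ _ i 0) //.
    by rewrite (@feval_fget _ _ tE _ _ i 0) // (same tS) // (same tE).
  apply: post.
  + by move=> t i' j /andP[h1 h2]; rewrite arr_setf (negbTE h2) /= same // h1.
  + by move=> i' ii; rewrite arr_setf /= same // ii orbT.
  + by rewrite arr_setf /= acc arr_setf !eqxx add0r.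
  + by rewrite arr_setf /= arr_setf.
Qed.

Lemma wp_apply_prog st Q : par st ->
  (forall st', iframe apply_prog st st' ->
     (forall t i j, (t != tV) && (t != tS) -> arr st' t i j = arr st t i j) ->
     (forall i, (i < U)%N ->
        arr st' tV i 0 = \sum_(c < U) arr st tW i c * arr st tE c 0) ->
     arr st' tS 1 0 = \sum_(i < U) arr st' tV i 0 * arr st tE i 0 -> Q st') ->
  wp apply_prog Q st.
Proof.
move=> pst post; apply: wp_seq; apply: (@wp_fset _ _ _ _ _ 1 0 0) => //= fr1.
set st1 := setf st tS 1 0 0 in fr1 *.
have pst1 : par st1 by apply: par_frame pst fr1 _ _.
have same1 t i j : (t != tV) && (t != tS) -> arr st1 t i j = arr st t i j.
  by case/andP=> _ h; rewrite arr_setf (negbTE h).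
apply: (@wp_for _ _ _ _ U (fun i st' =>
  [/\ forall t i j, (t != tV) && (t != tS) -> arr st' t i j = arr st t i j,
     (forall i', (i' < i)%N ->
        arr st' tV i' 0 = \sum_(c < U) arr st tW i' c * arr st tE c 0) &
     arr st' tS 1 0 = \sum_(i' < i) arr st' tV i' 0 * arr st tE i' 0])) => //.
- by move=> st' fr; rewrite /= fr // (par_U pst1).
- by split=> //; rewrite big_ord0 arr_seti [LHS]arr_setf.
- move=> i st' iU fr vl [h1 h2 h3].
  have pst' : par st' by apply: par_frame pst1 fr _ _.
  apply: (@wp_apply_row _ i) => // st'' g1 g2 g3 g4 _; split.
  + by move=> t i' j tt'; rewrite -h1 // -g1.
  + move=> i'; rewrite ltnS leq_eqVlt; case: eqP => [-> _|/eqP ii /= i'i].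
      by rewrite [LHS]g3; apply: eq_bigr => c _; rewrite !h1.
    by rewrite [LHS]g2 // h2.
  + rewrite [LHS]g4 big_ord_recr /= h3 h1 //; congr (_ + _).
    by apply: eq_bigr => i' _; rewrite -g2 // ltn_eqF.
- by move=> st' fr [h1 h2 h3]; apply: post.
Qed.

Lemma wp_update_prog st Q : par st ->
  (forall st', iframe update_prog st st' ->
     (forall t i j, t != tW -> arr st' t i j = arr st t i j) ->
     (forall i j, (i < U)%N -> (j < U)%N -> arr st' tW i j =
        arr st tW i j - arr st tV i 0 * arr st tV j 0 / arr st tS 1 0) -> Q st') ->
  wp update_prog Q st.
Proof.
move=> pst post.
pose new i j := arr st tW i j - arr st tV i 0 * arr st tV j 0 / arr st tS 1 0.
apply: (@wp_for _ _ _ _ U (fun i st' =>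
  (forall t i j, t != tW -> arr st' t i j = arr st t i j) /\
  (forall i' j, (j < U)%N -> arr st' tW i' j =
     if (i' < i)%N then new i' j else arr st tW i' j))) => //.
- by move=> st' fr; rewrite /= fr // (par_U pst).
- move=> i st' iU fr vl [h1 h2].
  (* Entries are updated in place, in lexicographic order; besides [tV] and [fden], each reads only
     its own old value. *)
  apply: (@wp_for _ _ _ _ U (fun j st'' =>
    (forall t i j, t != tW -> arr st'' t i j = arr st t i j) /\
    (forall i' j', (j' < U)%N -> arr st'' tW i' j' =
       if (i' < i)%N || (i' == i) && (j' < j)%N then new i' j'
       else arr st tW i' j'))) => //.
  + by move=> st'' fr''; rewrite /= fr'' // fr // (par_U pst).
  + by split=> // i' j' jU; rewrite andbF orbF; exact: h2.
  + move=> j st'' jU fr'' vl'' [g1 g2].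
    have ist : imem st'' (Negz vi) = i%:Z by rewrite fr''.
    apply: (@wp_fset _ _ _ _ _ i j (new i j)) => //.
      rewrite -[LHS]/(feval _ (fget _ _ _) -
        feval _ (fget _ _ _) * feval _ (fget _ _ _) / feval _ fden).
      rewrite (@feval_fget _ _ tW _ _ i j) // (@feval_fget _ _ tV _ _ i 0) //.
      rewrite (@feval_fget _ _ tV _ _ j 0) // (@feval_fget _ _ tS _ _ 1 0) //.
      by rewrite g2 // !g1 // ltnn ltnn andbF.
    move=> _; split=> [t i' j' h|i' j' j'U].
      by rewrite arr_seti [LHS]arr_setf (negbTE h) /= g1.
    rewrite arr_seti [LHS]arr_setf g2 //= ltnS (leq_eqVlt j').
    by case: (ltngtP i' i) => [||->] //=; case: (ltngtP j' j) => [||->].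
  + move=> st'' fr'' [g1 g2] _; split=> // i' j jU; rewrite [LHS]g2 // jU andbT.
    by rewrite ltnS (leq_eqVlt i') orbC.
- by move=> st' fr [h1 h2]; apply: post => // i j iU jU; rewrite h2 // iU.
Qed.

Definition eqn_col k : 'cV[R]_U := \col_c eqn_flat k c.

Lemma wp_solve_step st k Q : par st -> imem st (Negz vk) = k%:Z ->
  (k <= E)%N -> arr st tK 0 0 = k%:R ->
  (forall k', (k' <= E)%N -> arr st tT k' M = a k') ->
  (forall i c : 'I_U, arr st tW i c = projector eqn_col k i c) ->
  (forall st', (forall i j, arr st' tT i j = arr st tT i j) ->
     arr st' tK 0 0 = k.+1%:R ->
     (forall i c : 'I_U, arr st' tW i c = projector eqn_col k.+1 i c) -> Q st') ->
  wp solve_step Q st.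
Proof.
move=> pst kst kE kap tab proj post.
apply: wp_seq; apply: (@wp_equation_prog _ k) => // st1 _ f1 e1 fr1.
have pst1 : par st1 by apply: par_frame pst fr1 _ _.
apply: wp_seq; apply: wp_apply_prog => // st2 _ f2 e2 d2 fr2.
have pst2 : par st2 by apply: par_frame pst1 fr2 _ _.
apply: wp_seq; apply: wp_update_prog => // st3 _ f3 e3 fr3.
apply: (@wp_fset _ _ _ _ _ 0 0 k.+1%:R) => //.
  rewrite -[LHS]/(feval _ kappa + 1) (@feval_fget _ _ tK _ _ 0 0) //.
  by rewrite f3 // f2 // f1 // kap natr1.
apply: post.
- by move=> i j; rewrite arr_setf /= f3 // f2 // f1.
- by rewrite arr_setf.
have t2 (i : 'I_U) : arr st2 tV i 0 = (projector eqn_col k *m eqn_col k) i 0.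
  by rewrite e2 // mxE; apply: eq_bigr => c _; rewrite f1 // proj e1 // mxE.
have D2 : arr st2 tS 1 0 =
    ((eqn_col k)^T *m (projector eqn_col k *m eqn_col k)) 0 0.
  by rewrite d2 mxE; apply: eq_bigr => c _; rewrite t2 e1 // mulrC !mxE.
move=> i c; rewrite arr_setf /= e3 // f2 // f1 // proj !t2 D2.
rewrite [RHS]mxE; congr (_ + _); rewrite [RHS]mxE; congr (- _).
rewrite [RHS]mxE mulrC; congr (_ * _).
by rewrite [RHS]mxE big_ord1; congr (_ * _); rewrite [RHS]mxE.
Qed.

Lemma wp_solve_prog st Q : par st -> arr st tK 0 0 = 0 ->
  (forall k, (k <= E)%N -> arr st tT k M = a k) ->
  (forall i c : 'I_U, arr st tW i c = (i == c)%:R) ->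
  (forall st', iframe solve_prog st st' ->
     (forall i c : 'I_U, arr st' tW i c = projector eqn_col E i c) -> Q st') ->
  wp solve_prog Q st.
Proof.
move=> pst kap tab ident post; apply: (@wp_for _ _ _ _ E (fun k st' =>
  [/\ forall i j, arr st' tT i j = arr st tT i j, arr st' tK 0 0 = k%:R &
     forall i c : 'I_U, arr st' tW i c = projector eqn_col k i c])) => //.
- by move=> st' fr; rewrite /= fr // (par_E pst).
- by split=> // i c; rewrite [LHS]ident mxE.
- move=> k st' kE fr vl [h1 h2 h3].
  have pst' : par st' by apply: par_frame pst fr _ _.
  apply: (@wp_solve_step _ k) => //; first exact: ltnW.
    by move=> k' k'E; rewrite h1 tab.
  by move=> st'' g1 g2 g3 _; split=> // i j; rewrite -h1; exact: g1.
- by move=> st' fr [h1 h2 h3]; apply: post.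
Qed.

Lemma wp_select_prog st Q : par st ->
  (exists2 p, (p < U)%N & arr st tW p p != 0) ->
  (forall st' p, iframe select_prog st st' -> fmem st' = fmem st ->
     imem st' (Negz vp) = p%:Z -> (p < U)%N -> arr st tW p p != 0 -> Q st') ->
  wp select_prog Q st.
Proof.
move=> pst expiv post; apply: (@wp_for _ _ _ _ U (fun i st' =>
  fmem st' = fmem st /\ ((exists2 p, (p < i)%N & arr st tW p p != 0) ->
    exists p, [/\ imem st' (Negz vp) = p%:Z, (p < i)%N & arr st tW p p != 0]))) => //.
- by move=> st' fr; rewrite /= fr // (par_U pst).
- by split=> // -[].
- move=> i st' iU fr vl [h1 h2].
  have Wi : feval st' (fget tW (var vi) (var vi)) = arr st tW i i.
    by rewrite (@feval_fget _ _ _ _ _ i i) // /arr h1.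
  apply: wp_if => hb.
    apply: (@wp_iset _ _ _ i%:Z) => // _; split=> // _; exists i; split=> //.
    by move: hb; rewrite -[beval _ _]/(~~ (feval st' _ == 0)) Wi.
  apply: wp_skip => _; split=> // -[p pi Wp].
  have Wi0 : arr st tW i i = 0.
    by apply/eqP; move: hb; rewrite -[beval _ _]/(~~ (feval st' _ == 0)) Wi negbK.
  have [|p' [h3 h4 h5]] := h2.
    exists p => //; move: pi; rewrite ltnS leq_eqVlt => /orP[/eqP pi|//].
    by rewrite pi Wi0 eqxx in Wp.
  by exists p'; split=> //; exact: ltnW.
- by move=> st' fr [h1 /(_ expiv) [p [h2 h3 h4]]]; apply: (post st' p).
Qed.

Lemma wp_output_prog st (p : nat) Q : par st -> imem st (Negz vp) = p%:Z ->
  (forall st', imem st' 0 = L%:Z -> imem st' 1 = n%:Z ->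
     (forall c : nat, (c < U)%N -> fmem st' c%:Z = arr st tW p c) -> Q st') ->
  wp output_prog Q st.
Proof.
move=> pst pivst post; apply: wp_seq.
apply: (@wp_for _ _ _ _ U (fun i st' =>
  (forall t i j, arr st' t i j = arr st t i j) /\
  (forall c : nat, (c < i)%N -> fmem st' c%:Z = arr st tW p c))) => //.
- by move=> st' fr; rewrite /= fr // (par_U pst).
- move=> i st' iU fr vl [h1 h2].
  have W : feval st' (fget tW (var vp) (var vi)) = arr st tW p i.
    by rewrite (@feval_fget _ _ _ _ _ p i) //= fr.
  exists (State (imem st') (update (fmem st') i%:Z (arr st tW p i))).
    by rewrite -W -[in update _ i%:Z]vl; exact: exec_fset.
  move=> _; split=> // c; rewrite /= /update ltnS leq_eqVlt eqz_nat.
  by case: eqP => [->|_ /= ci] //; exact: h2.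
- move=> st' fr [h1 h2] _.
  have pst' : par st' by apply: par_frame pst fr _ _.
  apply: wp_seq; exists (State (update (imem st') 0 L%:Z) (fmem st')).
    by rewrite -(par_L pst'); exact: exec_iset.
  move=> _.
  exists (State (update (update (imem st') 0 L%:Z) 1 n%:Z) (fmem st')).
    by rewrite -(par_n pst'); exact: exec_iset.
  by apply: post.
Qed.

End Solver.

(** * The algorithm *)

Definition size_prog : cmd :=
  Seq (iset vM izero) (For vi (IGet izero) (iset vM (IAdd (var vM)
    (IMul (face_exp (var vi)) (face_exp (var vi)))))).

(** Computes the degree bound of [algebraic_equation] with [M] in place of [m.+1]. *)
Definition degree_prog : cmd :=
  Seq (iset vB (var vM))
    (For vi (var vM) (iset vB (IMul (var vB) (IMul (IConst 2) (var vM))))).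

Definition bounds_prog : cmd :=
  let B := var vB in
  let aux := IMul (IMul (IConst 2) (var vn)) B in
  Seq size_prog (Seq degree_prog
   (Seq (iset vn (IAdd B ione))
   (Seq (iset vL (IAdd (IAdd (IMul (IConst 4) (IMul B (IMul B B)))
            (IMul (IConst 4) (IMul B B))) (IMul (IConst 2) B)))
   (Seq (iset vU (IMul (IAdd (var vL) ione) (var vn)))
        (iset vE (IAdd (IAdd (IMul (IAdd (IAdd (var vL) aux) (IAdd aux ione))
            (IMul B B)) B) ione)))))).

Definition main_prog : cmd :=
  Seq bounds_prog (Seq table_init (Seq table_prog (Seq identity_prog
    (Seq solve_prog (Seq select_prog output_prog))))).

Lemma sum_ord_mul (V : nmodType) a n (f : nat -> V) :
  \sum_(c < a * n) f c = \sum_(i < a) \sum_(e < n) f (i * n + e)%N.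
Proof.
elim: a => [|a IHa]; first by rewrite !big_ord0.
by rewrite big_ord_recr /= -IHa mulSnr big_split_ord.
Qed.

(** * Bounds obtained from the faces, and correctness of the whole program *)

Section Run.
Variables (R : realType) (D : die R).

(** Squares bound absolute values and are computed by multiplication alone. *)
Definition die_size : nat := \sum_j (`|face D j| * `|face D j|)%N.
Definition die_degree : nat := (die_size * (2 * die_size) ^ die_size)%N.

Lemma face_le_size j : (`|face D j| <= die_size)%N.
Proof.
rewrite /die_size (bigD1 j) //=; apply: leq_trans (leq_addr _ _).
by case: `|_|%N => // k; rewrite leq_pmulr.
Qed.

Lemma die_size_gt0 : (0 < die_size)%N.
Proof.
have [j _] : exists j : 'I_(faces D), true.
  case: (D) => [[|r] f q _ _ _ /= q1 _]; last by exists ord0.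
  by move/eqP: q1; rewrite big_ord0 eq_sym oner_eq0.
apply: leq_trans (face_le_size j); rewrite absz_gt0; exact: face_neq0.
Qed.

Lemma die_degree_gt0 : (0 < die_degree)%N.
Proof. by have M0 := die_size_gt0; rewrite muln_gt0 M0 expn_gt0 muln_gt0 M0. Qed.

Let M := die_size.
Let B := die_degree.
Let n := rec_size B.
Let L := rec_order B.
Let U := (L.+1 * n)%N.
(** The projector handles the equations of index below [E]; the successor includes [rec_check B]. *)
Let E := (rec_check B).+1.

Lemma wp_size_prog Q :
  (forall st, iframe size_prog (input D) st -> fmem st = fmem (input D) ->
     imem st (Negz vM) = M%:Z -> Q st) -> wp size_prog Q (input D).
Proof.
move=> post; apply: wp_seq; apply: (@wp_iset _ _ _ 0) => // _.
apply: (@wp_for _ _ _ _ (faces D) (fun l st => fmem st = fmem (input D) /\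
  imem st (Negz vM) = (\sum_(j < faces D | (j < l)%N)
    (`|face D j| * `|face D j|))%N%:Z)) => //.
- by move=> st fr; rewrite /= fr.
- by split=> //; rewrite big_pred0.
- move=> l st lr fr vl [h1 h2].
  have fE : imem st (l%:Z + 1) = face D (Ordinal lr).
    rewrite (_ : l%:Z + 1 = l.+1%:Z); last by lia.
    by rewrite fr // -(input_face (Ordinal lr)).
  apply: (@wp_iset _ _ _ (\sum_(j < faces D | (j < l.+1)%N)
     (`|face D j| * `|face D j|))%N%:Z) => //.
  rewrite /= vl h2 fE [in RHS](bigD1 (Ordinal lr)) //= addnC PoszD.
  congr (_ + _); last by rewrite -abszM; nia.
  congr (Posz _); apply: eq_bigl => j.
  by rewrite -val_eqE /= ltnS ltn_neqAle andbC.
- move=> st fr [h1 h2]; apply: post => //; last first.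
    by rewrite h2 /M; congr (Posz _); apply: eq_bigl => j; rewrite ltn_ord.
  move=> z zw; rewrite fr; last by move: zw => /= /norP[].
  by rewrite imem_seti; move: zw => /= /norP[/negbTE ->].
Qed.

Lemma wp_degree_prog (st : state R) Q : imem st (Negz vM) = M%:Z ->
  (forall st', iframe degree_prog st st' -> fmem st' = fmem st ->
     imem st' (Negz vB) = B%:Z -> Q st') -> wp degree_prog Q st.
Proof.
move=> Mst post; apply: wp_seq; apply: (@wp_iset _ _ _ M%:Z) => // _.
apply: (@wp_for _ _ _ _ M (fun l st' => fmem st' = fmem st /\
  imem st' (Negz vB) = (M * (2 * M) ^ l)%N%:Z)) => //.
- by move=> st' fr; rewrite /= fr.
- by split=> //; rewrite muln1.
- move=> l st' lM fr vl [h1 h2].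
  apply: (@wp_iset _ _ _ (M * (2 * M) ^ l.+1)%N%:Z) => //.
  by rewrite /= h2 fr // [imem _ _]Mst expnSr; lia.
- move=> st' fr [h1 h2]; apply: post => // z zw.
  rewrite fr; last by move: zw => /= /norP[].
  by rewrite imem_seti; move: zw => /= /norP[/negbTE ->].
Qed.

Lemma wp_bounds_prog Q :
  (forall st, fmem st = fmem (input D) -> par D M n L U E st -> Q st) ->
  wp bounds_prog Q (input D).
Proof.
move=> post; apply: wp_seq; apply: wp_size_prog => st1 fr1 f1 M1 _.
apply: wp_seq; apply: (wp_degree_prog M1) => st2 fr2 f2 B2 _.
apply: wp_seq; apply: (@wp_iset _ _ _ n%:Z).
  by rewrite /= B2 /n /rec_size; lia.
move=> _; apply: wp_seq; apply: (@wp_iset _ _ _ L%:Z).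
  by rewrite /= /update /= B2 /L /rec_order !expnS expn0; lia.
move=> _; apply: wp_seq; apply: (@wp_iset _ _ _ U%:Z).
  by rewrite /= /update /= /U; lia.
move=> _; apply: (@wp_iset _ _ _ E%:Z).
  rewrite /= /update /= B2 /E /rec_check -/n -/L !expnS expn0; lia.
apply: post; first by rewrite -f1 -f2.
split=> //; first by rewrite /= /update /= fr2.
by move=> x; rewrite -(fr1 x%:Z) // -(fr2 x%:Z).
Qed.

Let A : fps R := wser (face D) (weight D) (fun=> 1) 0.
Let a k := fcoef A k.
Let W := projector (@eqn_col R n U a) E.

Lemma fcoef_recop_flat (c : nat -> nat -> R) k : fcoef (recop L n c A) k =
  \sum_(d < U) c (d %/ n)%N (d %% n)%N * eqn_flat n a k d.
Proof.
rewrite fcoef_recop (sum_ord_mul _ _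
  (fun d => c (d %/ n)%N (d %% n)%N * eqn_flat n a k d)).
apply: eq_bigr => i _; apply: eq_bigr => e _.
by rewrite eqn_flatE // divnMDl // modnMDl divn_small // modn_small // addn0.
Qed.

Lemma die_equation : exists P, [/\ P != 0, psubst A P = 0, bideg B B P &
  psubst A P^`() <> 0].
Proof.
have [m Mm] : exists m, M = m.+1.
  by exists M.-1; rewrite prednK ?die_size_gt0.
have sm j : (`|face D j| <= m.+1)%N by rewrite -Mm; exact: face_le_size.
have [P [P0 PA dP]] := algebraic_equation (weight D) sm.
have dP' : bideg B B P by rewrite /B /die_degree -/M Mm.
exact: separable_equation dP'.
Qed.

(** The recurrence of [recop_exists], flattened to a vector, solves all the equations, so [W] fixes
    it and cannot be zero. *)
Lemma solution_exists : exists p : 'I_U, W p p != 0.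
Proof.
have [P [P0 PA dP P'A]] := die_equation.
have [c [i [e [iL en c0]]] cA] := recop_exists die_degree_gt0 P0 PA dP P'A.
pose v : 'cV[R]_U := \col_d c (d %/ n)%N (d %% n)%N.
have [_ _ _ Wv] := projectorP (@eqn_col R n U a) E.
have {}Wv : W *m v = v.
  apply: Wv => l _; apply/matrixP => x y; rewrite !ord1 !mxE.
  have := congr1 (fun f => fcoef f l) cA; rewrite fcoef_recop_flat => H.
  by rewrite -[RHS]H; apply: eq_bigr => d _; rewrite !mxE mulrC.
have [|p Wp] := @projector_diag R U (@eqn_col R n U a) E; last by exists p.
apply: contraNneq c0 => W0.
have dU : (i * n + e < U)%N.
  rewrite /U; apply: (@leq_trans (i.+1 * n)%N); last exact: leq_mul.
  by rewrite mulSnr ltn_add2l.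
have : v (Ordinal dU) 0 = 0 by rewrite -Wv /W W0 mul0mx mxE.
by rewrite mxE /= divnMDl // modnMDl divn_small // modn_small // addn0 => ->.
Qed.

Lemma main_progP : exists2 st, exec main_prog (input D) st &
  exists2 p : 'I_U, W p p != 0 &
    [/\ imem st 0 = L%:Z, imem st 1 = n%:Z &
        forall c : 'I_U, fmem st (c : nat)%:Z = W p c].
Proof.
apply: wp_seq; apply: wp_bounds_prog => st1 f1 p1 _.
have w1 (j : 'I_(faces D)) : fmem st1 (j : nat)%:Z = weight D j.
  by rewrite f1 /= valK.
(* Array cells are negative, and there the input holds 0. *)
have z1 t i j : arr st1 t i j = 0 by rewrite /arr f1.
apply: wp_seq; apply: (wp_table_init p1) => st2 _ x2 t2 fr2.
have p2 : par D M n L U E st2 by apply: par_frame p1 fr2 _ _.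
apply: wp_seq; apply: (wp_table_prog face_le_size p2 die_size_gt0).
- by move=> j; rewrite x2.
- by move=> t; rewrite t2 /= z1; case: ltnP.
- by move=> k t; rewrite t2 /= z1.
move=> st3 _ f3 t3 fr3.
have p3 : par D M n L U E st3 by apply: par_frame p2 fr3 _ _.
apply: wp_seq; apply: (wp_identity_prog p3).
  by move=> i j; rewrite f3 // t2 /= z1.
move=> st4 _ f4 w4 fr4.
have p4 : par D M n L U E st4 by apply: par_frame p3 fr4 _ _.
apply: wp_seq; apply: (@wp_solve_prog _ _ _ _ _ _ _ a _ _ _ p4).
- by [].
- by rewrite f4 // f3 // t2 /= z1.
- by move=> k kE; rewrite f4 // t3 // /fpass subrr.
- by move=> i c; rewrite w4.
move=> st5 _ w5 fr5.
have p5 : par D M n L U E st5 by apply: par_frame p4 fr5 _ _.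
apply: wp_seq; apply: (wp_select_prog p5).
  by have [p Wp] := solution_exists; exists p; rewrite // w5.
move=> st6 p _ f6 i6 pU Wp fr6.
have p6 : par D M n L U E st6 by apply: par_frame p5 fr6 _ _.
apply: (wp_output_prog p6 i6) => st7 L7 n7 F7.
exists (Ordinal pU); first by rewrite -(w5 (Ordinal pU) (Ordinal pU)).
split=> // c; rewrite F7 // /arr f6; exact: (w5 (Ordinal pU) c).
Qed.

(** [W] kills every equation vector of index at most [rec_check B], so its row [p] solves these
    equations, and [recop_low] extends the recurrence to all indices. *)
Lemma output_recurrence st (p : 'I_U) : W p p != 0 ->
  imem st 0 = L%:Z -> imem st 1 = n%:Z ->
  (forall c : 'I_U, fmem st (c : nat)%:Z = W p c) ->
  satisfies_recurrence a (output_order st) (output_poly st).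
Proof.
move=> Wp L0 n0 F.
have -> : output_order st = L by rewrite /output_order L0.
have polyE i : output_poly st i = \poly_(e < n) fmem st (i * n + e)%N%:Z.
  by rewrite /output_poly n0.
pose c i e := fmem st (i * n + e)%N%:Z.
have [P [P0 PA dP P'A]] := die_equation.
have [_ _ We _] := projectorP (@eqn_col R n U a) E.
have cA : recop L n c A = 0.
  apply: (recop_low die_degree_gt0 P0 PA dP P'A) => k kE.
  have /matrixP/(_ p 0) := We k kE; rewrite [LHS]mxE [RHS]mxE => H.
  rewrite fcoef_recop_flat -[RHS]H; apply: eq_bigr => d _.
  by rewrite /c -divn_eq F [X in _ = _ * X]mxE.
have L_gt0 : (0 < L)%N.
  by rewrite /L /rec_order addn_gt0 muln_gt0 die_degree_gt0 orbT.
split=> //.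
  (* The nonzero entry [W p p] is the coefficient of ['X^(p %% n)] in this polynomial. *)
  exists (p %/ n)%N; first by rewrite -ltnS ltn_divLR.
  apply: contraNneq Wp => p0.
  have := congr1 (fun q : {poly R} => q`_(p %% n)) p0.
  by rewrite polyE coef_poly ltn_pmod // -divn_eq coef0 F => ->.
move=> k Lk; have := congr1 (fun f => fcoef f k) cA; rewrite fcoef_recop => H.
rewrite -[RHS]H; apply: eq_bigr => i _.
(* From [L] on, the convention for negative indices never applies. *)
have ik : (i <= k)%N by apply: leq_trans Lk; rewrite -ltnS.
rewrite polyE horner_poly mulr_suml; apply: eq_bigr => e _.
by rewrite ik mulrA.
Qed.

End Run.

Theorem theorem6 (R : realType) :
  (forall (D : die R) (d : measure_display) (T : measurableType d)
      (P : probability T R) (Y : nat -> {RV P >-> R}),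
    independent_rolls D Y -> P_recursive (rounds_pmf Y))
  /\
  (exists prog : cmd, forall D : die R, exists st : state R,
    exec prog (input D) st /\
    forall (d : measure_display) (T : measurableType d)
      (P : probability T R) (Y : nat -> {RV P >-> R}),
    independent_rolls D Y ->
    satisfies_recurrence (rounds_pmf Y) (output_order st) (output_poly st)).
Proof.
(* Both claims come from one run: the output of the program also witnesses P-recursiveness. *)
have run (D : die R) : exists2 st, exec main_prog (input D) st &
    forall (d : measure_display) (T : measurableType d)
      (P : probability T R) (Y : nat -> {RV P >-> R}),
    independent_rolls D Y ->
    satisfies_recurrence (rounds_pmf Y) (output_order st) (output_poly st).
  have [st ex [p Wp [h1 h2 h3]]] := main_progP D; exists st => // d T P Y rolls.
  have -> : rounds_pmf Y = fun k => fcoef (wser (face D) (weight D) (fun=> 1) 0) k.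
    by apply: funext => k; rewrite (rounds_pmfE rolls).
  exact: output_recurrence Wp h1 h2 h3.
split; last by exists main_prog => D; have [st ex sat] := run D; exists st.
move=> D d T P Y rolls; have [st _ sat] := run D.
by exists (output_order st), (output_poly st); apply: sat.
Qed.
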